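(* Let $k\ge 1$ and $n\ge 1$ be integers. Then $$ex(n, k\cdot P_3)=\begin{cases} \binom{n}{2}, & \text{if } n<3k;\\[2pt] \binom{3k-1}{2}+\left\lfloor\frac{n-3k+1}{2}\right\rfloor, & \text{if } 3k\le n<5k-1;\\[2pt] \binom{3k-1}{2}+k, & \text{if } n=5k-1;\\[2pt] \binom{k-1}{2}+(n-k+1)(k-1)+\left\lfloor\frac{n-k+1}{2}\right\rfloor, & \text{if } n>5k-1. \end{cases}$$ Further, the extremal graphs for $k\cdot P_3$ on $n$ vertices are, up to isomorphism, exactly the following. (1) If $n<3k$, the only extremal graph is $K_n$. (2) If $3k\le n<5k-1$, the only extremal graph is $K_{3k-1}\cup M_{n-3k+1}$. (3) If $n=5k-1$, the extremal graphs are exactly $K_{3k-1}\cup M_{2k}$ and $K_{k-1}+M_{4k}$ (for $k=1$ both are equal to $M_4$). (4) If $n>5k-1$, the only extremal graph is $K_{k-1}+M_{n-k+1}$.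
   Context: All graphs are finite and simple. $P_3$ is the path on $3$ vertices, and $k\cdot P_3$ is the disjoint union of $k$ copies of $P_3$. ''Contains $H$'' means contains $H$ as a (not necessarily induced) subgraph. The Turán number $ex(n,H)$ is the maximum number of edges in a graph on $n$ vertices which does not contain $H$ as a subgraph. An extremal graph for $H$ on $n$ vertices is a graph on $n$ vertices with exactly $ex(n,H)$ edges that does not contain $H$ as a subgraph. $K_m$ is the complete graph on $m$ vertices ($K_0$ is the empty graph with no vertices). $G\cup H$ denotes the disjoint union of the graphs $G$ and $H$. $G+H$ denotes the join: the graph obtained from the disjoint union $G\cup H$ by adding all edges between vertices of $G$ and vertices of $H$. $M_t$ is the graph on $t$ vertices that is the disjoint union of $\lfloor t/2\rfloor$ edges and $\lceil t/2\rceil-\lfloor t/2\rfloor$ isolated vertices. *)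

(* Defs.v *)
From HB Require Import structures.
From mathcomp Require Import all_boot.
Set Implicit Arguments.
Unset Strict Implicit.
Unset Printing Implicit Defensive.

(* A finite simple graph on the vertex type V is a set of 2-element subsets
   of V. For a fixed V these graphs form a finType, so that the maximum in
   [ex] below ranges over a finite type. *)
Record sgraph (V : finType) := SGraph {
  edges :> {set {set V}};
  _ : [forall e in edges, #|e| == 2]
}.

HB.instance Definition _ (V : finType) := [isSub for @edges V].
HB.instance Definition _ (V : finType) := [Countable of sgraph V by <:].
HB.instance Definition _ (V : finType) := [Finite of sgraph V by <:].

Lemma sgraph_proof (V : finType) (E : {set {set V}}) :
  (forall e, e \in E -> #|e| = 2) -> [forall e in E, #|e| == 2].
Proof. by move=> H; apply/forall_inP => e /H /eqP. Qed.

Lemma card_edge (V : finType) (G : sgraph V) (e : {set V}) :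
  e \in edges G -> #|e| = 2.
Proof. by case: G => E /= /forall_inP H /H /eqP. Qed.

(* G contains H as a (not necessarily induced) subgraph *)
Definition contains (V W : finType) (G : sgraph V) (H : sgraph W) : bool :=
  [exists f : {ffun W -> V},
     injectiveb f && [forall e in edges H, f @: e \in edges G]].

Definition isomorphic (V W : finType) (G : sgraph V) (H : sgraph W) : Prop :=
  exists f : V -> W,
    bijective f /\ forall e : {set V}, (f @: e \in edges H) = (e \in edges G).

Definition ex (n : nat) (W : finType) (H : sgraph W) : nat :=
  \max_(G : sgraph 'I_n | ~~ contains G H) #|edges G|.

(* G is an extremal graph for H on n vertices *)
Definition extremal (n : nat) (W : finType) (H : sgraph W)
    (V : finType) (G : sgraph V) : Prop :=
  [/\ #|V| = n, #|edges G| = ex n H & ~~ contains G H].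

Section Constructions.

Fact empty_subproof (n : nat) :
  [forall e in (set0 : {set {set 'I_n}}), #|e| == 2].
Proof. by apply: sgraph_proof => e; rewrite inE. Qed.

(* n isolated vertices *)
Definition edgeless (n : nat) : sgraph 'I_n := SGraph (empty_subproof n).

Fact complete_subproof (n : nat) :
  [forall e in [set e : {set 'I_n} | #|e| == 2], #|e| == 2].
Proof. by apply: sgraph_proof => e; rewrite inE => /eqP. Qed.

Definition complete (n : nat) : sgraph 'I_n := SGraph (complete_subproof n).

Definition path_edges (n : nat) : {set {set 'I_n}} :=
  [set [set p.1; p.2] | p in [set p : 'I_n * 'I_n | p.1.+1 == p.2]].

Fact path_subproof (n : nat) : [forall e in path_edges n, #|e| == 2].
Proof.
apply: sgraph_proof => e /imsetP[[i j]]; rewrite inE /= => /eqP ij ->.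
by rewrite cards2 -val_eqE /= -ij neq_ltn ltnSn.
Qed.

Definition path_graph (n : nat) : sgraph 'I_n := SGraph (path_subproof n).

Variables V W : finType.

Definition gunion_edges (G : sgraph V) (H : sgraph W) : {set {set V + W}} :=
  [set inl @: (e : {set V}) | e in edges G]
  :|: [set inr @: (e : {set W}) | e in edges H].

Fact gunion_subproof (G : sgraph V) (H : sgraph W) :
  [forall e in gunion_edges G H, #|e| == 2].
Proof.
apply: sgraph_proof => e; rewrite inE => /orP[] /imsetP[e0 e0E ->].
  by rewrite card_imset ?(card_edge e0E) // => x y [].
by rewrite card_imset ?(card_edge e0E) // => x y [].
Qed.

Definition gunion (G : sgraph V) (H : sgraph W) : sgraph (V + W)%type :=
  SGraph (gunion_subproof G H).

Definition gjoin_edges (G : sgraph V) (H : sgraph W) : {set {set V + W}} :=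
  gunion_edges G H :|: [set [set inl p.1; inr p.2] | p : V * W].

Fact gjoin_subproof (G : sgraph V) (H : sgraph W) :
  [forall e in gjoin_edges G H, #|e| == 2].
Proof.
apply: sgraph_proof => e; rewrite inE => /orP[/(card_edge (G := gunion G H))//|].
by move=> /imsetP[p _ ->]; rewrite cards2.
Qed.

Definition gjoin (G : sgraph V) (H : sgraph W) : sgraph (V + W)%type :=
  SGraph (gjoin_subproof G H).

Definition copies_edges (k : nat) (G : sgraph V) : {set {set 'I_k * V}} :=
  \bigcup_(i < k) [set pair i @: (e : {set V}) | e in edges G].

Fact copies_subproof (k : nat) (G : sgraph V) :
  [forall e in copies_edges k G, #|e| == 2].
Proof.
apply: sgraph_proof => e /bigcupP[i _ /imsetP[e0 e0E ->]].
by rewrite card_imset ?(card_edge e0E) // => x y [].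
Qed.

(* the disjoint union of k copies of G *)
Definition copies (k : nat) (G : sgraph V) : sgraph ('I_k * V)%type :=
  SGraph (copies_subproof k G).

End Constructions.

(* vertex type of [matching_graph t]; it has t elements *)
Definition matching_vertex (t : nat) : finType :=
  ('I_(t./2) * 'I_2 + 'I_(uphalf t - t./2))%type.

(* M_t: the disjoint union of floor(t/2) edges and
   ceil(t/2) - floor(t/2) isolated vertices *)
Definition matching_graph (t : nat) : sgraph (matching_vertex t) :=
  gunion (copies t./2 (complete 2)) (edgeless (uphalf t - t./2)).

Definition kP3 (k : nat) : sgraph ('I_k * 'I_3)%type := copies k (path_graph 3).

(* Main.v *)
Require Import Defs.
From mathcomp Require Import all_boot zify.

(** Write k = m + 1. A vertex set of size at least 3m + 2 without m + 1
    disjoint paths on three vertices is compared with two candidates: a clique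
    on 3m + 2 vertices beside a near-perfect matching, and m vertices joined to
    everything above a near-perfect matching. The second has m (n - (5m + 4))
    more edges than the first, so the maximum is the edge number of the first
    plus m times the truncated difference n - (5m + 4); this single formula,
    doubled, is [max_vol].

    The upper bound and the equality case are proved together, in
    [vol_max_shape], by induction on the number n of vertices: a set attaining
    the formula has one of the two shapes. For m = 0 the set spans a matching, so
    let m be positive. An isolated vertex or an isolated
    edge can be deleted. A vertex of degree at least 3m + 2 keeps two
    neighbours outside any m disjoint paths, so deleting it lowers m by one;
    the loss is at most n - 1 edges, exactly the difference of the two values
    of the formula when n >= 5m + 4, and too little to attain it below.

    In the remaining case all degrees are at most 3m + 1 and every vertex lies
    on a three-vertex path. Deleting such a path also lowers m by one, so by
    induction each path meets many edges. As the other two vertices of the path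
    have degree at most 3m + 1, every single vertex has large degree
    ([min_deg_path]). Now take a maximum packing of j <= m paths and let R be
    the set of the r uncovered vertices, which spans only a matching. Since no
    path of the packing can be exchanged for two paths using R, each of them
    sends at most max(6, r + 2) edges to R ([path_exchange]). Counting the edges
    leaving R from both sides contradicts the minimum degree ([packing_count],
    [count_absurd]).

    Conversely the two shapes hold no m + 1 disjoint paths: a path with no
    vertex in the clique, respectively in the dominating set, would lie in a
    matching, so each path takes three of the 3m + 2 vertices of the clique,
    respectively at least one of the m dominating vertices. Finally the shapes
    determine the graph up to isomorphism, because a near-perfect matching can
    be enumerated edge by edge ([near_matching_embedding]). *)
Set Implicit Arguments.
Unset Strict Implicit.
Unset Printing Implicit Defensive.

(** * Degrees and edge counts inside a vertex set *)

Section Packing.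
Variables (V : finType) (e : rel V).
Hypotheses (e_sym : symmetric e) (e_irr : irreflexive e).
Implicit Types (A B C D P R : {set V}) (x y v : V) (t : V * V * V).

Definition nbr A x := [set y in A | e x y].
Definition deg A x := #|nbr A x|.
(** Twice the number of edges inside [A]; degree sums avoid handling edge sets
    and halves. *)
Definition vol A := \sum_(x in A) deg A x.

Lemma degE A x : deg A x = \sum_(y in A) e x y.
Proof.
rewrite /deg /nbr -sum1_card.
rewrite (eq_bigl (fun y => (y \in A) && e x y)); last by move=> y; rewrite inE.
by rewrite big_mkcondr; apply: eq_bigr => y _; case: (e x y).
Qed.

Lemma degID A B x : deg A x = deg (A :&: B) x + deg (A :\: B) x.
Proof. by rewrite !degE (big_setID B). Qed.

Lemma sum_deg_sym A B : \sum_(x in A) deg B x = \sum_(x in B) deg A x.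
Proof.
under eq_bigr => x _ do rewrite degE.
rewrite exchange_big; apply: eq_bigr => y _ /=; rewrite degE.
by apply: eq_bigr => x _; rewrite e_sym.
Qed.

Lemma volID A B : B \subset A ->
  vol A = vol B + vol (A :\: B) + 2 * \sum_(x in B) deg (A :\: B) x.
Proof.
move=> BA; have AB : A :&: B = B by apply/setIidPr.
rewrite {1}/vol (big_setID B) /= AB.
under eq_bigr => x _ do rewrite (degID A B) AB.
under [X in _ + X]eq_bigr => x _ do rewrite (degID A B) AB.
rewrite !big_split /= (sum_deg_sym (A :\: B) B) -/(vol B) -/(vol (A :\: B)); lia.
Qed.

Lemma degD1 A v x : v \in A -> deg A x = e x v + deg (A :\ v) x.
Proof. by move=> vA; rewrite !degE (big_setD1 v). Qed.

Lemma degD1_self A v : deg (A :\ v) v = deg A v.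
Proof.
case: (boolP (v \in A)) => vA; first by rewrite (degD1 v vA) e_irr.
by congr (deg _ v); apply/setDidPl; rewrite disjoint_sym disjoints1.
Qed.

Lemma volD1 A v : v \in A -> vol A = vol (A :\ v) + 2 * deg A v.
Proof.
move=> vA; rewrite (@volID A [set v]) ?sub1set // big_set1 degD1_self.
by rewrite /vol big_set1 degE big_set1 e_irr.
Qed.

Lemma deg_subset A B x : A \subset B -> deg A x <= deg B x.
Proof.
by move=> AB; apply/subset_leq_card/subsetP => y; rewrite !inE => /andP[/(subsetP AB)->].
Qed.

Lemma deg_le_card A x : deg A x <= #|A|.
Proof. by apply/subset_leq_card/subsetP => y; rewrite inE => /andP[]. Qed.

Lemma deg_lt_card A x : x \in A -> deg A x < #|A|.
Proof. by move=> xA; rewrite -degD1_self (cardsD1 x A) xA ltnS deg_le_card. Qed.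

(** Gives the sharp bound for matchings on an odd number of vertices. *)
Lemma vol_even A : ~~ odd (vol A).
Proof.
have [n] := ubnP #|A|; elim: n A => // n IHn A.
have [-> _|[v vA]] := set_0Vmem A; first by rewrite /vol big_set0.
rewrite (cardsD1 v) vA (volD1 vA) => An; rewrite oddD mul2n odd_double addbF.
exact: IHn.
Qed.

Lemma vol_le A : vol A <= #|A| * #|A|.-1.
Proof.
rewrite -sum_nat_const; apply: leq_sum => x xA.
by rewrite -ltnS prednK ?deg_lt_card //; apply/card_gt0P; exists x.
Qed.

Definition clique A := [forall x in A, forall y in A, (x != y) ==> e x y].

Lemma cliqueP A :
  reflect {in A &, forall x y, x != y -> e x y} (clique A).
Proof.
apply: (iffP forall_inP) => [h x y xA yA xy|h x xA].
  by move/forall_inP: (h _ xA) => /(_ _ yA); rewrite xy.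
by apply/forall_inP => y yA; apply/implyP; apply: h.
Qed.

Lemma deg_full A x : (forall y, y \in A -> e x y) -> deg A x = #|A|.
Proof.
by move=> h; congr #|pred_of_set _|; apply/setP => y; rewrite inE andb_idr //; apply: h.
Qed.

Lemma deg_none A x : (forall y, y \in A -> ~~ e x y) -> deg A x = 0.
Proof.
by move=> h; apply/eqP; rewrite cards_eq0; apply/eqP/setP => y; rewrite !inE;
   apply/andP => -[/h/negP].
Qed.

Lemma deg_fullP A x : #|A| <= deg A x -> forall y, y \in A -> e x y.
Proof.
move=> h y yA; have /eqP E : nbr A x == A.
  by rewrite eqEcard h andbT; apply/subsetP => z; rewrite inE => /andP[].
by move: yA; rewrite -E inE => /andP[].
Qed.

Lemma vol_clique A : clique A -> vol A = #|A| * #|A|.-1.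
Proof.
move/cliqueP=> h; rewrite -sum_nat_const; apply: eq_bigr => x xA.
rewrite -degD1_self (cardsD1 x) xA /=; apply: deg_full => y.
by rewrite !inE => /andP[yx yA]; apply: h; rewrite // eq_sym.
Qed.

Lemma clique_vol A : #|A| * #|A|.-1 <= vol A -> clique A.
Proof.
move=> h; apply/cliqueP => x y xA yA xy.
have := h; rewrite (volD1 xA); have := vol_le (A :\ x).
have := deg_lt_card xA; have := cardsD1 x A; rewrite xA add1n => E.
rewrite E /= ltnS => d1 d2 d3.
have {}h : #|A :\ x| <= deg (A :\ x) x.
  rewrite degD1_self; move: d2 d3; case: #|A :\ x| => [//|c] /=; nia.
by apply: (deg_fullP h); rewrite !inE eq_sym xy.
Qed.

(** * Packings of three-vertex paths *)

Definition verts t : seq V := [:: t.1.1; t.1.2; t.2].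
Definition is_path t := e t.1.1 t.1.2 && e t.1.2 t.2.
Definition covered (ts : seq (V * V * V)) := flatten (map verts ts).
Definition packing A ts :=
  [&& all is_path ts, uniq (covered ts) & all (mem A) (covered ts)].
Definition packable A k := [exists ts : k.-tuple (V * V * V), packing A ts].

Lemma packableP A k :
  reflect (exists2 ts, packing A ts & size ts = k) (packable A k).
Proof.
apply: (iffP existsP) => [[ts h]|[ts h s]]; first by exists ts; rewrite ?size_tuple.
by exists (@Tuple _ _ ts (introT eqP s)).
Qed.

Lemma size_covered ts : size (covered ts) = 3 * size ts.
Proof. by elim: ts => //= t ts; rewrite /covered /= => ->; lia. Qed.


Lemma covered_cat ts us : covered (ts ++ us) = covered ts ++ covered us.
Proof. by rewrite /covered map_cat flatten_cat. Qed.

Lemma packingD A B ts :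
  packing (A :\: B) ts = packing A ts && [disjoint covered ts & B].
Proof.
rewrite /packing disjoint_has.
have -> : all (mem (A :\: B)) (covered ts) =
    all (mem A) (covered ts) && ~~ has (mem B) (covered ts).
  by rewrite -all_predC -all_predI; apply: eq_all => x; rewrite /= !inE andbC.
by rewrite -!andbA; do !bool_congr.
Qed.

(** Packings are cut and glued along this equation: what comes later in the
    list lives outside what the earlier paths cover. *)
Lemma packing_cat A ts us :
  packing A (ts ++ us) =
  packing A ts && packing (A :\: [set x in covered ts]) us.
Proof.
rewrite packingD /packing covered_cat !all_cat cat_uniq disjoint_has.
have -> : has (mem [set x in covered ts]) (covered us) =
    has (mem (covered ts)) (covered us).
  by apply: eq_has => x; rewrite /= inE.
by case: (all _ ts); rewrite //= -!andbA; do !bool_congr.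
Qed.

Lemma packing_perm A ts us : perm_eq ts us -> packing A ts = packing A us.
Proof.
move=> h; have h' : perm_eq (covered ts) (covered us).
  exact/perm_flatten/perm_map.
by rewrite /packing (perm_all _ h) (perm_uniq h') (perm_all _ h').
Qed.

Lemma packingS A B ts : A \subset B -> packing A ts -> packing B ts.
Proof.
move=> AB /and3P[h1 h2 h3]; rewrite /packing h1 h2; apply: sub_all h3 => x.
exact: (subsetP AB).
Qed.

Lemma packableS A B k : A \subset B -> packable A k -> packable B k.
Proof.
by move=> AB /packableP[ts h s]; apply/packableP; exists ts => //; apply: packingS h.
Qed.

Lemma card_covered A ts : packing A ts -> #|[set x in covered ts]| = 3 * size ts.
Proof. by case/and3P=> _ u _; rewrite cardsE (card_uniqP u) size_covered. Qed.

Lemma covered_sub A ts : packing A ts -> [set x in covered ts] \subset A.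
Proof. by case/and3P=> _ _ /allP h; apply/subsetP => x; rewrite inE => /h. Qed.

Lemma packable_card A k : packable A k -> 3 * k <= #|A|.
Proof.
case/packableP=> ts h <-; rewrite -(card_covered h).
exact/subset_leq_card/covered_sub.
Qed.

Lemma packable0 A : packable A 0.
Proof. by apply/packableP; exists [::]. Qed.

Lemma packable1 A a b c : a \in A -> b \in A -> c \in A -> a != c ->
  e a b -> e b c -> packable A 1.
Proof.
move=> aA bA cA ac ab bc; apply/packableP; exists [:: (a, b, c)] => //.
rewrite /packing /= /is_path /= ab bc aA bA cA !inE negb_or ac /= !andbT.
apply/andP; split; last by apply: contraTneq bc => ->; rewrite e_irr.
by apply: contraTneq ab => ->; rewrite e_irr.
Qed.

Lemma packableD A B j k :
  packable B j -> packable (A :\: B) k -> B \subset A -> packable A (j + k).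
Proof.
case/packableP=> ts h1 <- /packableP[us h2 <-] BA; apply/packableP.
exists (ts ++ us); last by rewrite size_cat.
rewrite packing_cat (packingS BA h1) (packingS _ h2) //; apply: setDS.
exact: covered_sub h1.
Qed.

Lemma degD1_gt A v x d : d.+1 < deg A x -> d < deg (A :\ v) x.
Proof.
move=> h; rewrite -ltnS; apply: leq_trans h _.
case: (boolP (v \in A)) => vA; first by rewrite (degD1 x vA); case: (e x v).
apply/leqW/deg_subset/subsetP => y yA; rewrite !inE yA andbT.
by apply: contraNneq vA => <-.
Qed.

Lemma two_nbrs A x : 1 < deg A x ->
  exists y z, [/\ y \in A, z \in A, y != z, e x y & e x z].
Proof.
case/card_gt1P=> y [z [+ + yz]]; rewrite !inE => /andP[yA xy] /andP[zA xz].
by exists y, z.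
Qed.

Lemma one_nbr A x : 0 < deg A x -> exists2 y, y \in A & e x y.
Proof. by case/card_gt0P=> y; rewrite !inE => /andP[yA xy]; exists y. Qed.

(** * Exchanging one path of a packing for two *)

(* The three side conditions under which two explicit paths form a packing. *)
Ltac distinct nR :=
  rewrite /= !inE !negb_or;
  repeat (apply/andP; split);
  first [done | assumption | apply: nR; assumption | rewrite eq_sym; assumption
        | rewrite eq_sym; apply: nR; assumption].
Ltac inside RA :=
  simpl; repeat (apply/andP; split); first [done | assumption | apply: RA; assumption].
Ltac adjacent e_sym :=
  apply/andP; split; simpl; first [assumption | rewrite e_sym; assumption].

(** Suppose that the path a - b - c sends more edges than that to R. If an end
    has three neighbours in R while one of the other two vertices has a
    neighbour w there, then w extends the edge between those two to a path, and
    the end with two neighbours other than w is a second one; if there is no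
    such w, the sum is at most r. So both ends have at most two neighbours, and
    b has at least three. If b has four or more, an end with two neighbours
    would share R with b, both being centres of disjoint paths; so both ends
    have at most one, and the sum is at most r + 2. If b has exactly three, both
    ends have two: either they share a neighbour w, and a - w - c is disjoint
    from a path centred at b, or each of them is the centre of its own path. *)
Lemma path_exchange R a b c : uniq [:: a; b; c] ->
  (forall x, x \in [:: a; b; c] -> x \notin R) ->
  e a b -> e b c -> ~~ packable ([set a; b; c] :|: R) 2 ->
  deg R a + deg R b + deg R c <= maxn 6 (#|R| + 2).
Proof.
move=> un dis ab bc np; set A := _ :|: R in np.
have aR : a \notin R by apply: dis; rewrite !inE eqxx.
have bR : b \notin R by apply: dis; rewrite !inE eqxx orbT.
have cR : c \notin R by apply: dis; rewrite !inE eqxx !orbT.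
have RA : {subset R <= A} by apply/subsetP/subsetUr.
have [aA bA cA] : [/\ a \in A, b \in A & c \in A] by rewrite !inE !eqxx !orbT.
have [ab' ac' bc'] : [/\ a != b, a != c & b != c].
  by move: un; rewrite /= !inE negb_or -andbA => /and4P[].
have nR x y : x \notin R -> y \in R -> x != y.
  by move=> xR yR; apply: contraNneq xR => ->.
have two_paths t t' : all (mem A) (verts t ++ verts t') ->
    uniq (verts t ++ verts t') -> is_path t -> is_path t' -> False.
  move=> sA u p p'; case/negP: np; apply/packableP; exists [:: t; t'] => //.
  by apply/and3P; split; rewrite //= p p'.
have C1 x y : x \notin R -> y \notin R -> x \in A -> y \in A -> x != y ->
    3 < deg R x -> 1 < deg R y -> False.
  move=> xR yR xA yA xy dx /two_nbrs[y1 [y2 [y1R y2R y12 yy1 yy2]]].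
  have /two_nbrs[x1 [x2 []]] : 1 < deg (R :\ y1 :\ y2) x.
    by do 2![apply: degD1_gt].
  rewrite !inE => /and3P[x1y2 x1y1 x1R] /and3P[x2y2 x2y1 x2R] x12 xx1 xx2.
  by apply: (two_paths (x1, x, x2) (y1, y, y2));
    [inside RA | distinct nR | adjacent e_sym | adjacent e_sym].
have C2 x y z : x \notin R -> y \notin R -> z \notin R ->
    x \in A -> y \in A -> z \in A -> x != y -> z != x -> z != y -> e x y ->
    0 < deg R x -> 2 < deg R z -> False.
  move=> xR yR zR xA yA zA xy' zx zy xy /one_nbr[w wR xw] dz.
  have /two_nbrs[z1 [z2 []]] : 1 < deg (R :\ w) z.
    exact: degD1_gt.
  rewrite !inE => /andP[z1w z1R] /andP[z2w z2R] z12 zz1 zz2.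
  by apply: (two_paths (w, x, y) (z1, z, z2));
    [inside RA | distinct nR | adjacent e_sym | adjacent e_sym].
have C3 w : w \in R -> e a w -> e c w -> 2 < deg R b -> False.
  move=> wR aw cw db.
  have /two_nbrs[z1 [z2 []]] : 1 < deg (R :\ w) b.
    exact: degD1_gt.
  rewrite !inE => /andP[z1w z1R] /andP[z2w z2R] z12 zz1 zz2.
  by apply: (two_paths (a, w, c) (z1, b, z2));
    [inside RA | distinct nR | adjacent e_sym | adjacent e_sym].
have C4 : 1 < deg R a -> 1 < deg R c -> (forall w, w \in R -> e a w -> ~~ e c w) ->
    False.
  move=> /two_nbrs[a1 [a2 [a1R a2R a12 aa1 aa2]]].
  move=> /two_nbrs[c1 [c2 [c1R c2R c12 cc1 cc2]]] dj.
  have ne w w' : w \in R -> e a w -> e c w' -> w != w'.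
    by move=> wR aw; apply: contraTneq => <-; apply: dj.
  have [ne1 ne2 ne3 ne4] : [/\ a1 != c1, a1 != c2, a2 != c1 & a2 != c2].
    by split; apply: ne.
  by apply: (two_paths (a1, a, a2) (c1, c, c2));
    [inside RA | distinct nR | adjacent e_sym | adjacent e_sym].
have {}C4 : 2 < deg R b -> 1 < deg R a -> 1 < deg R c -> False.
  move=> db da dc; apply: C4 => // w wR aw; apply/negP => cw.
  exact: C3 wR aw cw db.
have ba : e b a by rewrite e_sym.
have cb : e c b by rewrite e_sym.
have ne := (ab', ac', bc', eq_sym b a, eq_sym c a, eq_sym c b).
have := deg_le_card R a; have := deg_le_card R b; have := deg_le_card R c.
have Da : 2 < deg R a -> deg R b = 0 /\ deg R c = 0.
  move=> da; split; apply/eqP; rewrite -leqn0 leqNgt; apply/negP => d.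
    by apply: (C2 b c a); rewrite ?ne.
  by apply: (C2 c b a); rewrite ?ne.
have Dc : 2 < deg R c -> deg R b = 0 /\ deg R a = 0.
  move=> da; split; apply/eqP; rewrite -leqn0 leqNgt; apply/negP => d.
    by apply: (C2 b a c); rewrite ?ne.
  by apply: (C2 a b c); rewrite ?ne.
have Db x : x \in [:: a; c] -> 3 < deg R b -> 1 < deg R x -> False.
  by rewrite !inE => /orP[] /eqP->; apply: C1; rewrite ?ne.
have {}Db : 3 < deg R b -> deg R a <= 1 /\ deg R c <= 1.
  by move=> db; split; rewrite leqNgt; apply/negP; apply: Db;
    rewrite ?inE ?eqxx ?orbT.
move: Da Db Dc C4; clear; lia.
Qed.

(** In a maximum packing no path can be exchanged for two. *)
Lemma path_exchange_packing A ts t : packing A ts ->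
  ~~ packable A (size ts).+1 -> t \in ts ->
  let R := A :\: [set x in covered ts] in
  deg R t.1.1 + deg R t.1.2 + deg R t.2 <= maxn 6 (#|R| + 2).
Proof.
move=> pts np /perm_to_rem; move: (rem t ts) => us pe; move: pts np.
have supE x : (x \in covered ts) = (x \in verts t) || (x \in covered us).
  by rewrite (perm_mem (perm_flatten (perm_map verts pe))) mem_cat.
rewrite (packing_perm A pe) (perm_size pe) -cat1s packing_cat packingD => /and3P[pt pu dj].
move=> np /=; set R := A :\: _.
have [pa un vA] : [/\ is_path t, uniq (verts t) & all (mem A) (verts t)].
  by case/and3P: pt; rewrite /covered /= andbT => -> -> ->.
case/andP: (pa) => ab bc; apply: path_exchange => //.
  by move=> x xt; rewrite !inE supE xt.
apply: contraNN np => p2; rewrite -add2n; apply: packableD p2 _ _.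
  apply/packableP; exists us; rewrite // packingD pu /=.
  apply/pred0P => x /=; apply/andP => -[xu].
  have := disjointFr dj xu; rewrite inE /covered /= !inE => /negbT xt.
  by rewrite supE xu orbT /= orbF -orbA (negbTE xt).
apply/subsetP => x; rewrite !inE => /orP[|/andP[]//].
by move/allP: vA => h; rewrite -orbA => xt; apply: h; rewrite !inE.
Qed.

Lemma nopath_deg A x : ~~ packable A 1 -> x \in A -> deg A x <= 1.
Proof.
move=> np xA; rewrite leqNgt; apply: contra np.
move=> /two_nbrs[y [z [yA zA yz xy xz]]].
by apply: (@packable1 A y x z) => //; rewrite e_sym.
Qed.

Lemma vol_matching A : {in A, forall x, deg A x <= 1} -> vol A <= 2 * #|A|./2.
Proof.
move=> h; have : vol A <= #|A| by rewrite -sum1_card; apply: leq_sum.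
have := vol_even A; lia.
Qed.

Lemma sum_covered ts (f : V -> nat) :
  \sum_(x <- covered ts) f x = \sum_(t <- ts) (f t.1.1 + f t.1.2 + f t.2).
Proof.
elim: ts => [|t ts IH]; first by rewrite !big_nil.
by rewrite big_cons -IH -cat1s covered_cat big_cat /covered /= !big_cons big_nil addn0 addnA.
Qed.

(** The degrees of the uncovered vertices are counted through the matching
    that these vertices span and through the edges to the paths. *)
Lemma packing_count A ts d : packing A ts -> ~~ packable A (size ts).+1 ->
  {in A, forall x, d <= deg A x} ->
  let r := #|A| - 3 * size ts in
  r * d <= 2 * r./2 + size ts * maxn 6 (r + 2).
Proof.
move=> pts np dA; set P := [set x in covered ts]; set R := A :\: P.
have PA : P \subset A by apply: covered_sub.
have rE : #|A| - 3 * size ts = #|R|.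
  by rewrite -(card_covered pts) cardsD (setIidPr PA).
have AP : A :&: P = P by apply/setIidPr.
rewrite /= rE; have npR : ~~ packable R 1.
  apply: contra np => pR; rewrite -addn1; apply: (@packableD _ P) PA.
    apply/packableP; exists ts => //; case/and3P: pts => h1 h2 _.
    by rewrite /packing h1 h2; apply/allP => x; rewrite /= inE.
  exact: pR.
have : vol R <= 2 * #|R|./2 by apply: vol_matching => x; apply: nopath_deg.
have : \sum_(x in R) deg P x <= size ts * maxn 6 (#|R| + 2).
  rewrite sum_deg_sym; have -> : \sum_(x in P) deg R x = \sum_(x <- covered ts) deg R x.
    case/and3P: pts => _ u _; rewrite [RHS]big_uniq //.
    by apply: eq_bigl => x; rewrite inE.
  rewrite sum_covered -sum1_size big_distrl /= big_seq [leqRHS]big_seq.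
  by apply: leq_sum => t tts; rewrite mul1n; apply: path_exchange_packing.
have : #|R| * d <= \sum_(x in R) deg P x + vol R.
  rewrite -sum_nat_const -big_split; apply: leq_sum => x xR /=.
  by rewrite -{1}AP -(degID A P); apply: dA; case/setDP: xR.
clear; lia.
Qed.

(** * The two extremal shapes *)

(** A matching missing at most one vertex, stated through its degrees and its
    number of edges so that vertex deletions can be followed by arithmetic. *)
Definition near_matching A := [forall x in A, deg A x <= 1] && (vol A == 2 * #|A|./2).

Lemma near_matchingP A :
  reflect ({in A, forall x, deg A x <= 1} /\ vol A = 2 * #|A|./2) (near_matching A).
Proof. by apply: (iffP andP) => -[/forall_inP h /eqP]. Qed.

(** Twice the edge number of the clique with a matching, corrected by the
    excess m (n - (5m + 4)) of the other candidate; truncated subtraction selects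
    the larger of the two. *)
Definition max_vol m n :=
  (3 * m + 2) * (3 * m + 1) + 2 * (n - (3 * m + 2))./2 + 2 * (m * (n - (5 * m + 4))).

Definition clique_shape m A := exists B,
  [/\ B \subset A, #|B| = 3 * m + 2, clique B,
      {in B & A :\: B, forall x y, ~~ e x y} & near_matching (A :\: B)].

Definition hub_shape m A := exists B,
  [/\ B \subset A, #|B| = m, {in B & A, forall x y, x != y -> e x y}
    & near_matching (A :\: B)].

(** Both shapes are allowed at the threshold 5m + 4, where they have equally
    many edges. *)
Definition extremal_shape m A :=
  #|A| <= 5 * m + 4 /\ clique_shape m A \/ 5 * m + 4 <= #|A| /\ hub_shape m A.

Lemma cardDS A B : B \subset A -> #|A :\: B| = #|A| - #|B|.
Proof. by move=> BA; rewrite cardsD (setIidPr BA). Qed.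

Lemma vol_clique_shape m A : clique_shape m A ->
  vol A = (3 * m + 2) * (3 * m + 1) + 2 * (#|A| - (3 * m + 2))./2.
Proof.
case=> B [BA cB clB sep /near_matchingP[_ vD]].
rewrite (volID BA) vD cardDS // cB (vol_clique clB) cB.
rewrite big1 => [|x xB]; first by rewrite muln0 addn0 !addn2 /= addn1.
by apply: deg_none => y; apply: sep.
Qed.

Lemma vol_hub_shape m A : hub_shape m A ->
  vol A = m * m.-1 + 2 * (#|A| - m)./2 + 2 * (m * (#|A| - m)).
Proof.
case=> B [BA cB hub /near_matchingP[_ vD]].
have clB : clique B.
  by apply/cliqueP => x y xB yB; apply: hub => //; apply: (subsetP BA).
rewrite (volID BA) vD cardDS // cB (vol_clique clB) cB.
rewrite (eq_bigr (fun=> #|A| - m)); first by rewrite sum_nat_const cB.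
move=> x xB; rewrite -cB -cardDS //; apply: deg_full => y /setDP[yA yB].
by apply: hub => //; apply: contraNneq yB => <-.
Qed.

(** The numbers n - m and n - (3m + 2) have the same parity, so the two
    matchings always differ by exactly m + 1 edges, and the difference between
    the shapes is linear in n. *)
Lemma shape_vol m A : 3 * m + 2 <= #|A| -> extremal_shape m A -> vol A = max_vol m #|A|.
Proof.
rewrite /max_vol => h1 [[h2 /vol_clique_shape->]|[h2 /vol_hub_shape->]].
  have -> : #|A| - (5 * m + 4) = 0 by lia.
  by rewrite muln0 addn0.
move: h2; move: #|A| {h1} => n; clear => h.
have [d ->] : exists d, n = 5 * m + 4 + d by exists (n - (5 * m + 4)); lia.
have -> : 5 * m + 4 + d - (5 * m + 4) = d by lia.
have -> : (5 * m + 4 + d - (3 * m + 2))./2 = (m + 1) + d./2 by lia.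
have -> : (5 * m + 4 + d - m)./2 = 2 * m + 2 + d./2 by lia.
have -> : 5 * m + 4 + d - m = 4 * m + 4 + d by lia.
by case: m {h} => [|m] /=; nia.
Qed.

(** * Arithmetic of the bound *)

(** Past 5m + 4 each new vertex strictly raises the bound, and below it only
    every other one does. *)
Lemma max_vol_isolated m n : 0 < m -> 3 * m + 2 <= n -> max_vol m n.+1 <= max_vol m n ->
  n.+1 <= 5 * m + 4 /\ ~~ odd (n - (3 * m + 2)).
Proof.
rewrite /max_vol => m0 h.
case: (leqP n.+1 (5 * m + 4)) => h'.
  have -> : n.+1 - (5 * m + 4) = 0 by lia.
  have -> : n - (5 * m + 4) = 0 by lia.
  lia.
have -> : n.+1 - (5 * m + 4) = (n - (5 * m + 4)).+1 by lia.
rewrite mulnS; lia.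
Qed.

Lemma max_vol_mono m n : max_vol m n <= max_vol m n.+1.
Proof.
rewrite /max_vol; have : m * (n - (5 * m + 4)) <= m * (n.+1 - (5 * m + 4)).
  by rewrite leq_mul2l; lia.
lia.
Qed.

Lemma max_vol_mono2 m n : 3 * m + 2 <= n -> max_vol m n + 2 <= max_vol m n.+2.
Proof.
rewrite /max_vol; have : m * (n - (5 * m + 4)) <= m * (n.+2 - (5 * m + 4)).
  by rewrite leq_mul2l; lia.
lia.
Qed.

(** An isolated edge pays for two vertices only up to the threshold. *)
Lemma max_vol_edge m n : 0 < m -> 3 * m + 2 <= n -> max_vol m n.+2 <= max_vol m n + 2 ->
  n.+2 <= 5 * m + 4.
Proof.
rewrite /max_vol => m0 h; case: (leqP n.+2 (5 * m + 4)) => // h'.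
have -> : (n.+2 - (3 * m + 2))./2 = (n - (3 * m + 2))./2.+1 by lia.
have : m * (n - (5 * m + 4)) + m <= m * (n.+2 - (5 * m + 4)).
  by rewrite -mulnSr leq_mul2l; lia.
lia.
Qed.

(** A dominating vertex accounts exactly for the step from m to m + 1 at or
    beyond the threshold 5(m + 1) + 4, and falls short below it. *)
Lemma max_vol_hub m n : 3 * m + 5 <= n ->
  max_vol m n + 2 * n <= max_vol m.+1 n.+1 /\
  (max_vol m.+1 n.+1 <= max_vol m n + 2 * n -> 5 * m + 9 <= n.+1).
Proof.
rewrite /max_vol => h.
have -> : (n.+1 - (3 * m.+1 + 2))./2 = (n - (3 * m + 2))./2 - 1 by lia.
have : 0 < (n - (3 * m + 2))./2 by lia.
move: (_./2) => q q0.
case: (leqP (5 * m + 8) n) => h1.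
  split=> [|_]; last by lia.
  have [d ->] : exists d, n = 5 * m + 8 + d by exists (n - (5 * m + 8)); lia.
  have -> : 5 * m + 8 + d - (5 * m + 4) = d + 4 by lia.
  have -> : (5 * m + 8 + d).+1 - (5 * m.+1 + 4) = d by lia.
  nia.
have -> : n.+1 - (5 * m.+1 + 4) = 0 by lia.
case: (leqP n (5 * m + 4)) => h2.
  have -> : n - (5 * m + 4) = 0 by lia.
  nia.
have [d [d3 ->]] : exists d, d <= 3 /\ n = 5 * m + 4 + d by exists (n - (5 * m + 4)); lia.
have -> : 5 * m + 4 + d - (5 * m + 4) = d by lia.
by move: d d3 => [|[|[|[|d]]]] // _; nia.
Qed.

(** If every three-vertex path meets at least D edges and all degrees are at
    most 3m + 4, then every vertex of a path has degree at least D - 6(m + 1).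
    This is the value for D the step of the bound when three vertices are
    deleted and m + 1 drops to m; the cases come from the thresholds 5m + 9
    and 5m + 7 of the two bounds being compared. *)
Definition least_deg m n :=
  if n <= 5 * m + 7 then 3 * m + 3
  else if n <= 5 * m + 8 then 2 * m + 3 else n - (4 * m + 6).

Lemma max_vol_path m n : 3 * m + 6 <= n ->
  max_vol m (n - 3) + 2 * least_deg m n + 12 * m + 12 <= max_vol m.+1 n.
Proof.
move=> h; rewrite /max_vol /least_deg.
have -> : (n - 3 - (3 * m + 2))./2 = (n - (3 * m.+1 + 2))./2 by lia.
move: (_./2) => q.
case: (leqP n (5 * m + 7)) => h1 /=.
  have -> : n - 3 - (5 * m + 4) = 0 by lia.
  have -> : n - (5 * m.+1 + 4) = 0 by lia.
  nia.
case: (leqP n (5 * m + 8)) => h2 /=.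
  have -> : n = 5 * m + 8 by lia.
  have -> : 5 * m + 8 - 3 - (5 * m + 4) = 1 by lia.
  have -> : 5 * m + 8 - (5 * m.+1 + 4) = 0 by lia.
  nia.
have [d ->] : exists d, n = 5 * m + 9 + d by exists (n - (5 * m + 9)); lia.
have -> : 5 * m + 9 + d - 3 - (5 * m + 4) = d + 2 by lia.
have -> : 5 * m + 9 + d - (5 * m.+1 + 4) = d by lia.
have -> : 5 * m + 9 + d - (4 * m + 6) = m + 3 + d by lia.
nia.
Qed.

(** With r uncovered vertices the left side is at most r + (m + 1)(r + 2) unless
    r = 3; the hypotheses make r at least n - 3(m + 1), which suffices in each
    range of n. *)
Lemma count_absurd m n j : 3 * m + 6 <= n -> j <= m.+1 ->
  2 * (n - 3 * j)./2 + j * maxn 6 (n - 3 * j + 2) < (n - 3 * j) * least_deg m n.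
Proof.
move=> h jm; have : n = (n - 3 * j) + 3 * j by lia.
move: (n - 3 * j) => r nE; rewrite /least_deg.
have [r3|r4] : r = 3 \/ 3 < r by lia.
  have jE : j = m.+1 by lia.
  by rewrite r3 jE; case: (leqP n (5 * m + 7)) => h1 //=; [|case: (leqP n (5 * m + 8)) => h2]; nia.
have -> : maxn 6 (r + 2) = r + 2 by lia.
apply: (@leq_ltn_trans (r + m.+1 * (r + 2))).
  by apply: leq_add; [lia | rewrite leq_mul2r jm orbT].
case: (leqP n (5 * m + 7)) => h1 /=.
  nia.
case: (leqP n (5 * m + 8)) => h2 /=.
  nia.
have : m + 3 <= n - (4 * m + 6) by lia.
have : 2 * m + 6 <= r by lia.
move: (n - _) => d; nia.
Qed.

(** * Deletions and the extremal shapes *)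

Lemma deg0_none A x y : deg A x = 0 -> y \in A -> ~~ e x y.
Proof.
move/eqP; rewrite cards_eq0 => /eqP/setP/(_ y); rewrite !inE => h yA.
by move: h; rewrite yA => /negbT.
Qed.

Lemma deg_separated A B : {in B & A :\: B, forall x y, ~~ e x y} ->
  (forall x, x \in B -> deg A x <= deg B x) /\
  (forall x, x \in A :\: B -> deg A x <= deg (A :\: B) x).
Proof.
move=> sep; split=> x xB; rewrite (degID A B).
  by rewrite (@deg_none (A :\: B)) ?addn0 ?deg_subset ?subsetIr // => y; apply: sep.
by rewrite (@deg_none (A :&: B)) // => y /setIP[_ yB]; rewrite e_sym; apply: sep.
Qed.

(** The parity condition prevents two leftover vertices from both staying
    unmatched. *)
Lemma near_matching_union C D : D \subset C -> {in D & C :\: D, forall x y, ~~ e x y} ->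
  near_matching D -> near_matching (C :\: D) ->
  ~~ (odd #|D| && odd #|C :\: D|) -> near_matching C.
Proof.
move=> DC sep /near_matchingP[dD vD] /near_matchingP[dC vC] od; have [s1 s2] := deg_separated sep.
apply/near_matchingP; split.
  move=> x xC; case: (boolP (x \in D)) => xD; first exact: leq_trans (s1 x xD) (dD x xD).
  have xCD : x \in C :\: D by rewrite inE xD.
  exact: leq_trans (s2 x xCD) (dC x xCD).
rewrite (volID DC) vD vC big1 => [|x xD]; last by apply: deg_none => y; apply: sep.
rewrite -(cardsID D C) (setIidPr DC) muln0 addn0 -mulnDr; congr (2 * _).
by rewrite halfD (negbTE od).
Qed.

Lemma near_matching_set1 v : near_matching [set v].
Proof.
apply/near_matchingP; rewrite /vol big_set1 cards1 degE big_set1 e_irr; split=> // x.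
by move=> /set1P ->; rewrite degE big_set1 e_irr.
Qed.

Lemma clique_set2 u v : e u v -> clique [set u; v].
Proof.
move=> uv; apply/cliqueP => x y /set2P[]-> /set2P[]->; rewrite ?eqxx // => _.
by rewrite e_sym.
Qed.

Lemma card_edge2 u v : e u v -> #|[set u; v]| = 2.
Proof. by move=> uv; rewrite cards2; case: eqP uv => // ->; rewrite e_irr. Qed.

Lemma near_matching_set2 u v : e u v -> near_matching [set u; v].
Proof.
move=> uv; have c2 := card_edge2 uv.
apply/near_matchingP; rewrite (vol_clique (clique_set2 uv)) c2; split=> // x xuv.
by rewrite -ltnS -c2 deg_lt_card.
Qed.

(** Serves to put back a deleted isolated vertex or isolated edge: it is absorbed
    by the matching. *)
Lemma clique_shape_union m A D : D \subset A ->
  {in D & A :\: D, forall x y, ~~ e x y} -> near_matching D ->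
  ~~ (odd #|D| && odd (#|A :\: D| - (3 * m + 2))) ->
  clique_shape m (A :\: D) -> clique_shape m A.
Proof.
move=> DA sep nD od [B [BAD cB clB sepB nB]].
have [BA disBD] : B \subset A /\ [disjoint B & D].
  by apply/andP; rewrite -subsetD.
have comm : A :\: B :\: D = A :\: D :\: B by rewrite !setDDl setUC.
exists B; split=> //.
  move=> x y xB; rewrite inE => /andP[yB yA].
  case: (boolP (y \in D)) => yD; last by apply: sepB; rewrite // !inE yB yD.
  by rewrite e_sym; apply: sep => //; apply: (subsetP BAD).
apply: (@near_matching_union _ D) => //.
- by rewrite subsetD DA disjoint_sym.
- by move=> x y xD /setDP[/setDP[yA _] yD]; apply: sep => //; rewrite inE yD.
- by rewrite comm.
by rewrite comm (cardDS BAD) cB.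
Qed.

Lemma near_matching_edge A : near_matching A -> 2 <= #|A| ->
  exists x y, [/\ x \in A, y \in A, e x y,
    {in [set x; y] & A :\: [set x; y], forall z w, ~~ e z w}
    & near_matching (A :\: [set x; y])].
Proof.
move=> /near_matchingP[d1 vA] A2; have [x xA dx] : exists2 x, x \in A & 0 < deg A x.
  apply/exists_inP; apply: contraTT (ltnSn (vol A)) => /exists_inPn h.
  rewrite -leqNgt vA; suff : vol A = 0 by lia.
  by apply: big1 => x /h; case: (deg A x).
have [y yA xy] := one_nbr dx; have yx : e y x by rewrite e_sym.
have DA : [set x; y] \subset A by rewrite subUset !sub1set xA.
have sep : {in [set x; y] & A :\: [set x; y], forall z w, ~~ e z w}.
  move=> z w; case/set2P=> ->; rewrite !inE negb_or => /andP[/andP[wx wy] wA].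
    apply: (@deg0_none (A :\ y)); last by rewrite !inE wy.
    by have := d1 x xA; rewrite (degD1 x yA) xy; case: deg.
  apply: (@deg0_none (A :\ x)); last by rewrite !inE wx.
  by have := d1 y yA; rewrite (degD1 y xA) yx; case: deg.
exists x, y; split=> //; have /near_matchingP[_ v2] := near_matching_set2 xy.
apply/near_matchingP; split.
  move=> z /setDP[zA _]; apply: leq_trans (d1 z zA).
  exact/deg_subset/subsetDl.
move: (volID DA); rewrite vA v2 (card_edge2 xy) big1 => [|z zD]; last first.
  by apply: deg_none => w; apply: sep.
by rewrite cardDS // (card_edge2 xy); clear -A2; lia.
Qed.

(** The case m = 0, where there is no path at all. Below the threshold 4 one of
    the edges plays the role of the clique on two vertices. *)
Lemma shape_matching A : 2 <= #|A| -> ~~ packable A 1 -> max_vol 0 #|A| <= vol A ->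
  extremal_shape 0 A.
Proof.
move=> A2 np hv; have d1 x : x \in A -> deg A x <= 1 by apply: nopath_deg.
have nA : near_matching A.
  apply/near_matchingP; split=> //.
  by have := vol_matching d1; move: hv; rewrite /max_vol; clear -A2; lia.
case: (leqP 4 #|A|) => A4; [right | left].
  split=> //; exists set0; split; rewrite ?sub0set ?cards0 ?setD0 //.
  by move=> x y; rewrite inE.
split; first by lia.
have [x [y [xA yA xy sep nD]]] := near_matching_edge nA A2.
exists [set x; y]; split=> //; first by rewrite subUset !sub1set xA.
  exact: card_edge2.
exact: clique_set2.
Qed.

Lemma hub_shapeD1 m A v : v \in A -> #|A|.-1 <= deg A v -> hub_shape m (A :\ v) ->
  hub_shape m.+1 A.
Proof.
move=> vA dv [B [BA cB hub nB]].
have hv y : y \in A -> v != y -> e v y.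
  move=> yA vy; apply: (@deg_fullP (A :\ v)); last by rewrite !inE eq_sym vy.
  by rewrite degD1_self; move: dv; rewrite (cardsD1 v A) vA.
have vB : v \notin B by apply: contraTN isT => /(subsetP BA); rewrite !inE eqxx.
exists (v |: B); split.
- by rewrite subUset sub1set vA (subset_trans BA) // subD1set.
- by rewrite cardsU1 vB cB.
- move=> x y /setU1P[->|xB] yA xy; first exact: hv.
  have [yv|yv] := eqVneq y v; last by apply: hub; rewrite // !inE yv.
  rewrite e_sym yv; apply: hv; last by rewrite -yv eq_sym.
  by move: (subsetP BA _ xB) => /setD1P[].
by rewrite -setDDl.
Qed.

(** The k paths cover 3k vertices, so two neighbours of [v] remain and [v] is the
    centre of one more path. *)
Lemma packable_hub k A v : v \in A -> 3 * k + 2 <= deg A v ->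
  packable (A :\ v) k -> packable A k.+1.
Proof.
move=> vA dv /packableP[ts pts s]; set P := [set x in covered ts].
have PA : P \subset A :\ v by apply: covered_sub.
have cP : #|P| = 3 * k by rewrite (card_covered pts) s.
have vP : v \notin P by apply: contraTN isT => /(subsetP PA); rewrite !inE eqxx.
have : 1 < deg (A :\: P) v.
  move: dv; rewrite (degID A P) -cP.
  have := deg_le_card (A :&: P) v; have := subset_leq_card (subsetIr A P).
  by clear; lia.
case/two_nbrs=> y [z [yA zA yz vy vz]].
rewrite -addn1; apply: (@packableD _ P); last by rewrite (subset_trans PA) // subD1set.
  apply/packableP; exists ts => //; case/and3P: pts => h1 h2 _.
  by rewrite /packing h1 h2; apply/allP => x; rewrite /= inE.
by apply: (@packable1 _ y v z); rewrite // ?in_setD ?vP // e_sym.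
Qed.

(** The two edges of the path are counted twice in the degree sum, hence the 4
    on the scale of doubled edge numbers. *)
Lemma vol_path A a b c : a \in A -> b \in A -> c \in A -> a != c -> e a b -> e b c ->
  vol A + 4 <= vol (A :\: [set a; b; c]) + 2 * (deg A a + deg A b + deg A c).
Proof.
move=> aA bA cA ac ab bc.
have ab' : a != b by apply: contraTneq ab => ->; rewrite e_irr.
have bc' : b != c by apply: contraTneq bc => ->; rewrite e_irr.
have aA' : a \in A :\ b by rewrite !inE ab'.
have cA' : c \in A :\ b :\ a by rewrite !inE eq_sym ac eq_sym bc'.
have -> : A :\: [set a; b; c] = A :\ b :\ a :\ c.
  by apply/setP=> x; rewrite !inE; case: (x == a) (x == b) (x == c) => [] [] [].
rewrite (volD1 bA) (volD1 aA') (volD1 cA') (degD1 a bA) (degD1 c bA) ab.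
rewrite [e c b]e_sym bc; have := @deg_subset (A :\ b :\ a) (A :\ b) c (subD1set _ _).
by clear; lia.
Qed.

(** Deleting a path through [x] leaves at most the inductive bound; the other two
    vertices account for at most 3m + 4 edges each, and [x] for the rest. *)
Lemma min_deg_path m A x : 3 * m + 6 <= #|A| ->
  {in A, forall x, deg A x <= 3 * m + 4} ->
  max_vol m.+1 #|A| <= vol A ->
  (forall D, D \subset A -> #|D| = 3 -> packable D 1 -> vol (A :\: D) <= max_vol m (#|A| - 3)) ->
  (exists a b c, [/\ [/\ a \in A, b \in A & c \in A], a != c, e a b, e b c
     & x \in [set a; b; c]]) ->
  least_deg m #|A| <= deg A x.
Proof.
move=> hn dA hv hD [a [b [c [[aA bA cA] ac ab bc xabc]]]].
have := vol_path aA bA cA ac ab bc.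
have D3 : #|[set a; b; c]| = 3.
  rewrite setUC cardsU1 cards2 !inE negb_or eq_sym ac.
  have -> : a != b by apply: contraTneq ab => ->; rewrite e_irr.
  by have -> : c != b by apply: contraTneq bc => ->; rewrite e_irr.
have : vol (A :\: [set a; b; c]) <= max_vol m (#|A| - 3).
  apply: hD => //; first by rewrite !subUset !sub1set aA bA.
  by apply: (@packable1 _ a b c); rewrite // !inE eqxx ?orbT.
have := max_vol_path hn; have := dA a aA; have := dA b bA; have := dA c cA.
move: xabc; rewrite !inE => /orP[/orP[]|] /eqP->; move: hv; clear; lia.
Qed.

Lemma in_path A x : 0 < deg A x ->
  (exists2 y, y \in A & e x y && (1 < maxn (deg A x) (deg A y))) -> x \in A ->
  exists a b c, [/\ [/\ a \in A, b \in A & c \in A], a != c, e a b, e b c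
     & x \in [set a; b; c]].
Proof.
move=> dx [y yA /andP[xy]]; rewrite leq_max => /orP[] d2 xA.
  have [y1 [y2 [y1A y2A ne e1 e2]]] := two_nbrs d2.
  by exists y1, x, y2; split; rewrite // ?inE ?eqxx ?orbT // e_sym.
have /one_nbr[z /setD1P[zx zA] yz] : 0 < deg (A :\ x) y by apply: degD1_gt.
by exists x, y, z; split; rewrite // ?inE ?eqxx // eq_sym.
Qed.

Lemma max_packing m A : ~~ packable A m.+1 ->
  exists2 j, j <= m & packable A j && ~~ packable A j.+1.
Proof.
elim: m => [|m IHm] np; first by exists 0; rewrite // packable0.
case: (boolP (packable A m.+1)) => [p|/IHm[j jm h]]; first by exists m.+1; rewrite // p.
by exists j; rewrite // leqW.
Qed.

(** * The upper bound with its equality case *)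

(** The equality case contains the bound: a set exceeding [max_vol] would have one
    of the shapes, hence by [shape_vol] not exceed it after all. This is how the
    induction hypothesis is used as an upper bound. *)
Lemma vol_max_shape m A : 3 * m + 2 <= #|A| -> ~~ packable A m.+1 ->
  max_vol m #|A| <= vol A -> extremal_shape m A.
Proof.
have [N] := ubnP #|A|; elim: N m A => // N IHN m A; rewrite ltnS => AN hA np hv.
have {AN} IH m' A' : #|A'| < #|A| -> 3 * m' + 2 <= #|A'| -> ~~ packable A' m'.+1 ->
    max_vol m' #|A'| <= vol A' -> extremal_shape m' A'.
  by move=> h; apply: IHN; apply: leq_trans h AN.
have bound m' A' : #|A'| < #|A| -> 3 * m' + 2 <= #|A'| -> ~~ packable A' m'.+1 ->
    vol A' <= max_vol m' #|A'|.
  move=> h1 h2 h3; rewrite leqNgt; apply/negP => lt.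
  by have := shape_vol h2 (IH _ _ h1 h2 h3 (ltnW lt)); move: lt; clear; lia.
have [m0|m0] := posnP m; first by rewrite m0 in hA np hv *; apply: shape_matching.
case: (leqP #|A| (3 * m + 2)) => hA'.
  have cA : #|A| = 3 * m + 2 by apply/eqP; rewrite eqn_leq hA' hA.
  left; split; first by lia.
  exists A; split=> //.
  - apply: clique_vol; move: hv; rewrite /max_vol cA; clear; nia.
  - by move=> x y _; rewrite setDv inE.
  by rewrite setDv; apply/near_matchingP; rewrite /vol big_set0 cards0; split=> // x; rewrite inE.
(* An isolated vertex: the bound cannot grow when it is put back, which forces
   n <= 5m + 4 and leaves an even number of vertices for the matching. *)
case: (boolP [exists v in A, deg A v == 0]) => [/exists_inP[v vA /eqP dv]|iso].
  have cA := cardsD1 v A; rewrite vA add1n in cA.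
  have vE := volD1 vA; rewrite dv muln0 addn0 in vE.
  have lt : #|A :\ v| < #|A| by rewrite cA.
  have h2 : 3 * m + 2 <= #|A :\ v| by rewrite -ltnS -cA.
  have np' : ~~ packable (A :\ v) m.+1 by apply: contra np; apply/packableS/subD1set.
  have le := bound _ _ lt h2 np'.
  rewrite vE cA in hv; have [h3 h4] := max_vol_isolated m0 h2 (leq_trans hv le).
  have [[h5 sh]|[h5 _]] := IH m _ lt h2 np' (leq_trans (max_vol_mono _ _) hv).
    left; rewrite cA; split=> //; apply: (@clique_shape_union _ _ [set v]) => //.
    - by rewrite sub1set.
    - by move=> x y /set1P-> /setD1P[_ yA]; apply: deg0_none yA.
    - exact: near_matching_set1.
    by rewrite (negbTE h4) andbF.
  by exfalso; move: h3 h5; clear; lia.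
(* An isolated edge. For n = 3m + 3 the remaining 3m + 1 vertices are too few for
   the induction hypothesis, but even a clique on them has too few edges. *)
case: (boolP [exists u in A, exists v in A, [&& e u v, deg A u == 1 & deg A v == 1]]).
  move=> /exists_inP[u uA /exists_inP[v vA /and3P[uv /eqP du /eqP dv]]].
  have vu : e v u by rewrite e_sym.
  have DA : [set u; v] \subset A by rewrite subUset !sub1set uA.
  have c2 := card_edge2 uv.
  have cA : #|A| = #|A :\: [set u; v]|.+2.
    by have := subset_leq_card DA; rewrite cardDS // c2; clear; lia.
  have sep x y : x \in [set u; v] -> y \in A :\: [set u; v] -> ~~ e x y.
    case/set2P=> ->; rewrite !inE negb_or => /andP[/andP[yu yv] yA].
      apply: (@deg0_none (A :\ v)); last by rewrite !inE yv.
      by move: du; rewrite (degD1 u vA) uv => -[].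
    apply: (@deg0_none (A :\ u)); last by rewrite !inE yu.
    by move: dv; rewrite (degD1 v uA) vu => -[].
  have vE : vol A = vol (A :\: [set u; v]) + 2.
    rewrite (volID DA) (vol_clique (clique_set2 uv)) c2 big1 => [|x xD].
      by rewrite muln0 addn0 addnC.
    by apply: deg_none => y; apply: sep.
  set A' := A :\: _ in cA sep vE.
  have lt : #|A'| < #|A| by rewrite cA.
  have np' : ~~ packable A' m.+1 by apply: contra np; apply/packableS/subsetDl.
  have [h2|h2] : #|A'| = 3 * m + 1 \/ 3 * m + 2 <= #|A'|.
  - by move: hA'; rewrite cA; clear; lia.
  - exfalso; have := vol_le A'; move: hv; rewrite vE cA /max_vol h2; move: m0; clear.
    rewrite addn1 /=; nia.
  have le := bound _ _ lt h2 np'.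
  rewrite vE cA in hv.
  have h3 : #|A'|.+2 <= 5 * m + 4.
    by apply: (max_vol_edge m0 h2); apply: leq_trans hv _; rewrite leq_add2r.
  have hv' : max_vol m #|A'| <= vol A'.
    by rewrite -(leq_add2r 2); apply: leq_trans hv; apply: max_vol_mono2.
  have [[h5 sh]|[h5 _]] := IH m _ lt h2 np' hv'.
    left; rewrite cA; split=> //; apply: (@clique_shape_union _ _ [set u; v]) => //.
      exact: near_matching_set2.
    by rewrite c2.
  by exfalso; move: h3 h5; clear; lia.
move=> isoe; case: m m0 hA hA' np hv iso isoe => // m _ hA hA' np hv iso isoe.
(* A vertex of large degree must be adjacent to everything, and n is then beyond
   the threshold, so that the rest is of the dominated shape. *)
case: (boolP [exists v in A, 3 * m.+1 + 2 <= deg A v]) => [/exists_inP[v vA dv]|dA].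
  have cA := cardsD1 v A; rewrite vA add1n in cA.
  have vE := volD1 vA.
  have lt : #|A :\ v| < #|A| by rewrite cA.
  have np' : ~~ packable (A :\ v) m.+1 by apply: contra np; apply: packable_hub.
  have h1 : 3 * m + 5 <= #|A :\ v| by move: hA'; rewrite cA; clear; lia.
  have h2 : 3 * m + 2 <= #|A :\ v| by move: h1; clear; lia.
  have dv' := deg_lt_card vA; rewrite cA ltnS in dv'.
  have le := bound _ _ lt h2 np'; rewrite vE cA in hv.
  have [h3 h4] := max_vol_hub h1.
  have h5 : 5 * m + 9 <= #|A :\ v|.+1 by apply: h4; move: hv le dv'; clear; lia.
  have hv' : max_vol m #|A :\ v| <= vol (A :\ v) by move: hv h3 dv'; clear; lia.
  have [[h6 _]|[_ sh]] := IH m _ lt h2 np' hv'.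
    by exfalso; move: h5 h6; clear; lia.
  right; rewrite cA; split; first by move: h5; clear; lia.
  apply: (hub_shapeD1 vA) => //; rewrite cA /=; move: hv h3 le; clear; lia.
have {}dA : {in A, forall x, deg A x <= 3 * m + 4}.
  move=> x xA; rewrite leqNgt; apply: contraNN dA => dx.
  by apply/exists_inP; exists x => //; move: dx; clear; lia.
(* Without isolated vertices and isolated edges every vertex lies on a path, so
   that the minimum degree is large enough for the count to be absurd. *)
have hn : 3 * m + 6 <= #|A| by move: hA'; clear; lia.
have mind : {in A, forall x, least_deg m #|A| <= deg A x}.
  move=> x xA; apply: min_deg_path => //.
    move=> D DA D3 pD; rewrite -D3 -cardDS //; apply: bound.
    - by rewrite cardDS // D3; move: hn; clear; lia.
    - by rewrite cardDS // D3; move: hn; clear; lia.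
    by apply: contra np => p; rewrite -add1n; apply: packableD pD p DA.
  have dx : 0 < deg A x by rewrite lt0n; move/exists_inPn: iso => /(_ x xA).
  apply: in_path => //; have [y yA xy] := one_nbr dx; exists y => //; rewrite xy /=.
  rewrite ltnNge geq_max; apply: contra isoe => /andP[dx1 dy1].
  apply/exists_inP; exists x => //; apply/exists_inP; exists y => //.
  rewrite xy !eqn_leq dx dx1 dy1 /=; apply/card_gt0P; exists x.
  by rewrite inE xA e_sym.
have [j jm /andP[/packableP[ts pts sj] npj]] := max_packing np.
rewrite -sj in npj jm; have := packing_count pts npj mind.
by rewrite /= leqNgt count_absurd.
Qed.

(** * The extremal shapes hold no larger packing *)

Lemma packing_mem A ts t : packing A ts -> t \in ts ->
  [/\ e t.1.1 t.1.2, e t.1.2 t.2, t.1.1 != t.2,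
      t.1.1 \in A & t.1.2 \in A /\ t.2 \in A].
Proof.
move=> pts /perm_to_rem pe; move: pts; rewrite (packing_perm A pe) -cat1s.
rewrite packing_cat => /andP[/and3P[]]; rewrite /covered /is_path /= !andbT !inE.
by rewrite negb_or -!andbA => /andP[-> ->] /and3P[_ -> _] /and3P[-> -> ->].
Qed.

(** The middle of a path would have two partners. *)
Lemma path_not_near_matching A a b c : near_matching A ->
  a \in A -> c \in A -> b \in A -> a != c ->
  e a b -> e b c -> False.
Proof.
move=> /near_matchingP[d1 _] aA cA bA ac ab bc; have := d1 b bA.
rewrite (degD1 b aA) e_sym ab (@degD1 (A :\ a) c) ?bc //.
by rewrite !inE eq_sym ac.
Qed.

(** A path starting in the clique stays there, and the clique is one vertex too
    small for m + 1 paths. *)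
Lemma clique_shape_nopack m A : clique_shape m A -> ~~ packable A m.+1.
Proof.
move=> [B [BA cB _ sep nB]]; apply/negP => /packableP[ts pts s].
suff /(@packable_card _ m.+1) : packable B m.+1 by rewrite cB; lia.
have sep' x y : x \in A -> y \in A -> e x y -> (x \in B) = (y \in B).
  move=> xA yA xy; case: (boolP (x \in B)) (boolP (y \in B)) => xB [] yB //.
    by have := sep x y xB; rewrite inE yB yA xy => /(_ isT).
  by have := sep y x yB; rewrite inE xB xA e_sym xy => /(_ isT).
apply/packableP; exists ts => //; case/and3P: (pts) => h1 h2 _.
rewrite /packing h1 h2 /=; apply/allP => x /flatten_mapP[t tts].
have [ab bc ac aA [bA cA]] := packing_mem pts tts.
have bB : t.1.2 \in B.
  case: (boolP (t.1.2 \in B)) => // bB; exfalso.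
  by apply: (path_not_near_matching nB _ _ _ ac ab bc); rewrite in_setD ?bB //;
    [rewrite (sep' _ _ aA bA ab) bB | rewrite -(sep' _ _ bA cA bc) bB].
rewrite !inE => /or3P[] /eqP-> //=; first by rewrite (sep' _ _ aA bA ab).
by rewrite -(sep' _ _ bA cA bc).
Qed.

(** Each path uses one of the m dominating vertices. *)
Lemma hub_shape_nopack m A : hub_shape m A -> ~~ packable A m.+1.
Proof.
move=> [B [BA cB _ nB]]; apply/negP => /packableP[ts pts s].
suff : size ts <= #|B| by rewrite cB s ltnn.
have : \sum_(x <- covered ts) (x \in B) <= #|B|.
  case/and3P: (pts) => _ u _; rewrite big_uniq //= -sum1_card big_mkcond /=.
  rewrite [leqRHS]big_mkcond; apply: leq_sum => x _.
  by case: ifP => //; case: (x \in B).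
apply: leq_trans; rewrite sum_covered -sum1_size big_seq [leqRHS]big_seq.
apply: leq_sum => t tts; have [ab bc ac aA [bA cA]] := packing_mem pts tts.
rewrite lt0n !addn_eq0 !eqb0 -!andbA; apply/negP => /and3P[aB bB cB'].
by apply: (path_not_near_matching nB _ _ _ ac ab bc); rewrite inE ?aB ?bB ?cB'.
Qed.

End Packing.

(** * Adjacency, containment and isomorphism *)

Definition adj (V : finType) (G : sgraph V) : rel V :=
  fun x y => [set x; y] \in edges G.

Lemma imset_pair (aT rT : finType) (f : aT -> rT) x y :
  f @: [set x; y] = [set f x; f y].
Proof. by rewrite imsetU1 imset_set1. Qed.

Lemma nth_flatten_const (T : eqType) (x0 : T) (c : nat) (ss : seq (seq T)) i j :
  all (fun s => size s == c) ss -> i < size ss -> j < c ->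
  nth x0 (flatten ss) (c * i + j) = nth x0 (nth [::] ss i) j.
Proof.
elim: ss i => [|s ss IH] [|i] //= /andP[/eqP cs h] ii jc.
  by rewrite muln0 nth_cat cs jc.
rewrite nth_cat cs mulnS -addnA ltnNge leq_addr /= addKn.
exact: IH.
Qed.

Section Graphs.
Variables (V W : finType).
Implicit Types (G : sgraph V) (H : sgraph W).

Lemma adj_sym G : symmetric (adj G).
Proof. by move=> x y; rewrite /adj setUC. Qed.

Lemma adj_irr G : irreflexive (adj G).
Proof. by move=> x; apply/negP => /card_edge; rewrite setUid cards1. Qed.

(** Each edge at x is [set x; y] for exactly one neighbour y; then exchange the
    sums over vertices and edges. *)
Lemma vol_edges G : vol (adj G) setT = 2 * #|edges G|.
Proof.
have degG x : deg (adj G) setT x = \sum_(e in edges G) (x \in e).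
  rewrite -big_mkcondr sum1_card.
  have <- : #|[set [set x; y] | y in nbr (adj G) setT x]| = deg (adj G) setT x.
    apply: card_in_imset => y z; rewrite !inE => xy _ yz.
    have : y \in [set x; z] by rewrite -yz !inE eqxx orbT.
    by rewrite !inE => /orP[/eqP yx|/eqP//]; rewrite yx adj_irr in xy.
  apply: eq_card => e; rewrite [RHS]inE; apply/imsetP/andP => [[y]|[eG xe]].
    by rewrite !inE => xy ->; rewrite !inE eqxx.
  have /eqP/cards2P[a [b [ab eab]]] := card_edge eG.
  move: xe; rewrite eab in eG *; rewrite !inE => /orP[] /eqP ->.
    by exists b; rewrite // !inE.
  by exists a; rewrite ?inE ?[[set b; a]]setUC // /adj setUC.
rewrite /vol; under eq_bigr => x _ do rewrite degG.
rewrite exchange_big /= mulnC -sum_nat_const; apply: eq_bigr => e /card_edge <-.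
by rewrite -sum1_card [RHS]big_mkcond /=; apply: eq_big => [x|x _]; rewrite ?inE //; case: (x \in e).
Qed.

(** The map is inverted so that isomorphisms with the constructed graphs can be
    given by parametrising the vertices of [G]. *)
Lemma isomorphicP G H :
  isomorphic G H <->
  exists2 g : W -> V, bijective g & forall x y, adj G (g x) (g y) = adj H x y.
Proof.
split=> [[f [[g fK gK] h]]|[f [g fK gK] h]].
  exists g; first by exists f.
  by move=> x y; rewrite /adj -h imset_pair !gK.
exists g; split=> [|e]; first by exists f.
have inj_g : injective g by apply: can_inj gK.
case: (boolP (#|e| == 2)) => [/cards2P[x [y [_ ->]]]|c2].
  by rewrite imset_pair -!/(adj _ _ _) -h !gK.
transitivity false; last by apply/esym/negbTE/(contraNN _ c2) => /card_edge->.
by apply/negbTE/(contraNN _ c2) => /card_edge <-; rewrite card_imset.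
Qed.

Lemma isomorphic_card G H : isomorphic G H -> #|V| = #|W|.
Proof. by case=> f [/bij_eq_card]. Qed.

Lemma covered_map (I J : eqType) (f : I * J -> V) (s : seq I) j0 j1 j2 :
  covered [seq (f (i, j0), f (i, j1), f (i, j2)) | i <- s] =
  [seq f p | p <- [seq (i, j) | i <- s, j <- [:: j0; j1; j2]]].
Proof. by elim: s => //= i s; rewrite /covered /= => ->. Qed.

(** A copy lists its paths in the order of the index i; conversely vertex (i, j)
    is placed at position 3i + j of the covered vertices, and injectivity is the
    absence of repetitions. *)
Lemma contains_kP3 G k : contains G (kP3 k.+1) = packable (adj G) setT k.+1.
Proof.
apply/idP/idP => [/existsP[f /andP[/injectiveP f_inj /forall_inP f_adj]]|].
  pose o j : 'I_3 := inord j.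
  have oE j : j < 3 -> o j = j :> nat by move=> h; apply: inordK.
  have f_edge i j : j < 2 -> adj G (f (i, o j)) (f (i, o j.+1)).
    move=> j2; rewrite /adj -imset_pair; apply: f_adj; apply/bigcupP; exists i => //.
    rewrite -imset_pair imset_f //; apply/imsetP; exists (o j, o j.+1) => //.
    by rewrite inE /= !oE //; apply: leqW.
  apply/packableP.
  exists [seq (f (i, o 0), f (i, o 1), f (i, o 2)) | i <- enum 'I_k.+1].
    apply/and3P; split.
    - by apply/allP => t /mapP[i _ ->]; rewrite /is_path /= !f_edge.
    - rewrite covered_map map_inj_uniq //; apply: allpairs_uniq.
      + exact: enum_uniq.
      + by rewrite /= !inE -!val_eqE /= !oE.
      + by move=> [? ?] [? ?].
    by apply/allP => x _; rewrite /= in_setT.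
  by rewrite size_map size_enum_ord.
case/packableP=> ts pts sts; have [[[x0 y0] z0] _ _] : exists2 t, t \in ts & true.
  by case: ts sts {pts} => // t ts _; exists t; rewrite ?inE ?eqxx.
pose tt := map (@verts V) ts.
have stt : size tt = k.+1 by rewrite size_map.
have att : all (fun s => size s == 3) tt by rewrite all_map; apply/allP.
pose f := [ffun p : 'I_k.+1 * 'I_3 => nth x0 (nth [::] tt p.1) p.2].
have fE i j : f (i, j) = nth x0 (covered ts) (3 * i + j).
  by rewrite ffunE /= nth_flatten_const ?stt.
case/and3P: (pts) => pa un _.
apply/existsP; exists f; apply/andP; split.
  apply/injectiveP => -[i j] [i' j'] /eqP; rewrite !fE nth_uniq //.
  - move=> /eqP h; have [h1 h2] : (i : nat) = i' /\ (j : nat) = j'.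
      by move: h (ltn_ord j) (ltn_ord j'); lia.
    by rewrite (val_inj h1) (val_inj h2).
  - by rewrite size_covered sts; have := ltn_ord i; have := ltn_ord j; lia.
  - by rewrite size_covered sts; have := ltn_ord i'; have := ltn_ord j'; lia.
apply/forall_inP => e /bigcupP[i _ /imsetP[e0 /imsetP[[p q]]]].
rewrite inE /= => /eqP pq -> ->; rewrite !imset_pair -/(adj _ _ _) !ffunE /=.
rewrite (nth_map (x0, y0, z0)) ?sts //.
have its : i < size ts by rewrite sts.
have := allP pa _ (mem_nth (x0, y0, z0) its).
case: (nth _ ts i) => [[a b] c] /andP[/= ab bc].
case: p q pq => [[|[|p]] /= hp] [q hq] /= E; rewrite -E //=.
by move: hq; rewrite -E.
Qed.

Lemma adj_complete n x y : adj (complete n) x y = (x != y).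
Proof. by rewrite /adj in_set cards2; case: (x == y). Qed.

Lemma adj_edgeless n x y : adj (edgeless n) x y = false.
Proof. by rewrite /adj inE. Qed.

Lemma adj_copies k G i j x y :
  adj (copies k G) (i, x) (j, y) = (i == j) && adj G x y.
Proof.
apply/bigcupP/andP => [[l _ /imsetP[e eG E]]|[/eqP <- xy]]; last first.
  by exists i => //; rewrite -imset_pair imset_f.
have /imsetP[x' _ [il _]] : (i, x) \in pair l @: e by rewrite -E !inE eqxx.
have /imsetP[y' _ [jl _]] : (j, y) \in pair l @: e by rewrite -E !inE eqxx orbT.
rewrite il jl eqxx; split=> //; move: E; rewrite il jl -imset_pair.
by rewrite /adj => /imset_inj -> // ? ? [].
Qed.

Lemma adj_gunion_l G H x y : adj (gunion G H) (inl x) (inl y) = adj G x y.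
Proof.
rewrite /adj inE -imset_pair mem_imset; last by apply: imset_inj => ? ? [].
apply: orb_idr => /imsetP[e _ /setP/(_ (inl x))].
by rewrite imset_pair !inE eqxx => /esym/imsetP[].
Qed.

Lemma adj_gunion_r G H x y : adj (gunion G H) (inr x) (inr y) = adj H x y.
Proof.
rewrite /adj inE -imset_pair orbC mem_imset; last by apply: imset_inj => ? ? [].
apply: orb_idr => /imsetP[e _ /setP/(_ (inr x))].
by rewrite imset_pair !inE eqxx => /esym/imsetP[].
Qed.

Lemma adj_gunion_lr G H x y : adj (gunion G H) (inl x) (inr y) = false.
Proof.
rewrite /adj inE; apply/negbTE; rewrite negb_or; apply/andP; split.
  apply/imsetP => -[e _ /setP/(_ (inr y))].
  by rewrite !inE eqxx orbT => /esym/imsetP[].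
apply/imsetP => -[e _ /setP/(_ (inl x))].
by rewrite !inE eqxx => /esym/imsetP[].
Qed.

Lemma adj_gjoin_l G H x y : adj (gjoin G H) (inl x) (inl y) = adj G x y.
Proof.
rewrite /adj inE -[[set inl x; inl y] \in _]/(adj (gunion G H) _ _) adj_gunion_l.
apply: orb_idr => /imsetP[p _ /setP/(_ (inr p.2))].
by rewrite !inE eqxx orbT.
Qed.

Lemma adj_gjoin_r G H x y : adj (gjoin G H) (inr x) (inr y) = adj H x y.
Proof.
rewrite /adj inE -[[set inr x; inr y] \in _]/(adj (gunion G H) _ _) adj_gunion_r.
apply: orb_idr => /imsetP[p _ /setP/(_ (inl p.1))].
by rewrite !inE eqxx.
Qed.

Lemma adj_gjoin_lr G H x y : adj (gjoin G H) (inl x) (inr y) = true.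
Proof. by rewrite /adj !inE; apply/orP; right; apply/imsetP; exists (x, y). Qed.

End Graphs.

(** * The extremal shapes up to isomorphism *)

Lemma adj_matching t (x y : matching_vertex t) :
  adj (matching_graph t) x y =
  match x, y with
  | inl (i, b), inl (j, c) => (i == j) && (b != c)
  | _, _ => false
  end.
Proof.
case: x y => [[i b]|x] [[j c]|y].
- by rewrite adj_gunion_l adj_copies adj_complete.
- exact: adj_gunion_lr.
- by rewrite adj_sym; apply: adj_gunion_lr.
by rewrite adj_gunion_r adj_edgeless.
Qed.

Lemma card_matching_vertex t : #|matching_vertex t| = t.
Proof. by rewrite card_sum card_prod !card_ord; lia. Qed.

Lemma nbr_matching t (i : 'I_t./2) (b : 'I_2) :
  nbr (adj (matching_graph t)) setT (inl (i, b)) = [set inl (i, rev_ord b)].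
Proof.
apply/setP => -[[j c]|y]; rewrite !inE adj_matching //=.
rewrite -[RHS]/((j, c) == (i, rev_ord b)) xpair_eqE eq_sym; congr (_ && _).
by case: b c => [[|[|b]] hb] [[|[|c]] hc].
Qed.

Lemma near_matching_matching t : near_matching (adj (matching_graph t)) setT.
Proof.
have degr y : deg (adj (matching_graph t)) setT (inr y) = 0.
  by apply: deg_none => x _; rewrite adj_matching.
have degl p : deg (adj (matching_graph t)) setT (inl p) = 1.
  by case: p => i b; rewrite /deg nbr_matching cards1.
apply/near_matchingP; split=> [[p|y] _|]; rewrite ?degl ?degr //.
rewrite cardsT card_matching_vertex /vol.
rewrite (eq_bigl predT); last by move=> x; rewrite inE.
rewrite big_sumType /= [X in _ + X]big1 // addn0 (eq_bigr (fun=> 1)) //.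
by rewrite sum_nat_const muln1 card_prod !card_ord mulnC.
Qed.

Lemma near_matching_imset (V W : finType) (e : rel V) (e' : rel W) (h : W -> V) (A : {set W}) :
  injective h -> (forall x y, e (h x) (h y) = e' x y) ->
  near_matching e' A -> near_matching e (h @: A).
Proof.
move=> h_inj eh /near_matchingP[d1 vA].
have degh x : deg e (h @: A) (h x) = deg e' A x.
  rewrite /deg -(card_imset _ h_inj); apply: eq_card => y; rewrite inE.
  apply/andP/imsetP => [[/imsetP[z zA ->] xz]|[z]].
    by exists z; rewrite // inE zA -eh.
  by rewrite inE => /andP[zA xz] ->; rewrite imset_f // eh.
apply/near_matchingP; split=> [y /imsetP[x xA ->]|]; first by rewrite degh d1.
rewrite card_imset // -vA /vol big_imset /=; last by move=> x y _ _ /h_inj.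
by apply: eq_bigr => x _; rewrite degh.
Qed.

Section Shapes.
Variables (V : finType) (G : sgraph V).

Lemma imset_sum_split (V1 V2 : finType) (g : V1 + V2 -> V) : bijective g ->
  setT :\: [set g (inl x) | x in setT] = [set g (inr y) | y in setT].
Proof.
move=> g_bij; have g_inj := bij_inj g_bij; case: g_bij => f fK gK.
apply/setP => z; rewrite -(gK z) !inE andbT; case: (f z) => x.
  rewrite imset_f //=; apply/esym/negbTE/imsetP => -[y _ /g_inj]//.
rewrite imset_f ?inE //; apply/imsetP => -[y _ /g_inj]//.
Qed.

Lemma iso_clique_shape m t :
  isomorphic G (gunion (complete (3 * m + 2)) (matching_graph t)) ->
  clique_shape (adj G) m setT.
Proof.
case/isomorphicP=> g g_bij gE; have g_inj := bij_inj g_bij.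
exists [set g (inl x) | x in setT]; rewrite imset_sum_split //; split.
- exact: subsetT.
- by rewrite card_imset ?cardsT ?card_ord // => x y /g_inj[].
- apply/cliqueP => _ _ /imsetP[x _ ->] /imsetP[y _ ->].
  rewrite gE adj_gunion_l adj_complete; apply: contraNneq => ->//.
- by move=> _ _ /imsetP[x _ ->] /imsetP[y _ ->]; rewrite gE adj_gunion_lr.
apply: (@near_matching_imset _ _ _ (adj (matching_graph t))); last exact: near_matching_matching.
  by move=> x y /g_inj[].
by move=> x y; rewrite gE adj_gunion_r.
Qed.

Lemma iso_hub_shape m t :
  isomorphic G (gjoin (complete m) (matching_graph t)) -> hub_shape (adj G) m setT.
Proof.
case/isomorphicP=> g g_bij gE; have g_inj := bij_inj g_bij.
exists [set g (inl x) | x in setT]; rewrite imset_sum_split //; split.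
- exact: subsetT.
- by rewrite card_imset ?cardsT ?card_ord // => x y /g_inj[].
- move=> _ z /imsetP[x _ ->]; case: g_bij => f fK gK _; rewrite -(gK z).
  case: (f z) => y; rewrite gE ?adj_gjoin_lr // adj_gjoin_l adj_complete.
  by apply: contraNneq => ->.
apply: (@near_matching_imset _ _ _ (adj (matching_graph t))); last exact: near_matching_matching.
  by move=> x y /g_inj[].
by move=> x y; rewrite gE adj_gjoin_r.
Qed.

(** Remove an edge; what remains is again a near-perfect matching. *)
Lemma near_matching_edges C : near_matching (adj G) C -> exists s : seq (V * V),
  [/\ all (fun p => adj G p.1 p.2) s,
      uniq (flatten [seq [:: p.1; p.2] | p <- s]),
      {subset flatten [seq [:: p.1; p.2] | p <- s] <= C} & size s = #|C|./2].
Proof.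
have [n] := ubnP #|C|; elim: n C => // n IHn C Cn nC.
have [C1|C2] := leqP #|C| 1.
  by exists [::]; split=> //; move: C1; case: #|C| => [|[]].
have [x [y [xC yC xy _ nD]]] := near_matching_edge (@adj_sym _ G) (@adj_irr _ G) nC C2.
have DC : [set x; y] \subset C by rewrite subUset !sub1set xC.
have cD := cardDS DC; rewrite (card_edge2 (@adj_irr _ G) xy) in cD.
have [|s [s1 s2 s3 s4]] := IHn _ _ nD; first by move: C2 Cn; rewrite cD; clear; lia.
have nxy z : z \in [set x; y] -> z \notin flatten [seq [:: p.1; p.2] | p <- s].
  by move=> zxy; apply/negP => /s3; rewrite inE zxy.
exists ((x, y) :: s); split=> /=.
- by rewrite xy.
- rewrite s2 !inE negb_or !nxy ?inE ?eqxx ?orbT // !andbT.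
  by apply: contraTneq xy => ->; rewrite adj_irr.
- move=> z; rewrite !inE => /or3P[/eqP->|/eqP->|/s3/setDP[]] //.
by rewrite s4 cD; move: C2; clear; lia.
Qed.

(** The i-th edge of the list gives the i-th copy of the edge, and what the edges
    leave uncovered gives the isolated vertices. There are no other adjacencies,
    because each covered vertex has its partner as its only neighbour. *)
Lemma near_matching_embedding C t : near_matching (adj G) C -> #|C| = t ->
  exists h : matching_vertex t -> V,
    [/\ injective h, forall x, h x \in C
      & forall x y, adj G (h x) (h y) = adj (matching_graph t) x y].
Proof.
move=> nC Ct; have [C0|[x0 x0C]] := set_0Vmem C.
  have no (x : matching_vertex t) : False.
    have : 0 < #|matching_vertex t| by apply/card_gt0P; exists x.
    by rewrite card_matching_vertex -Ct C0 cards0.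
  by exists (fun x => False_rect V (no x)); split=> x; case: (no x).
have [s [s1 s2 s3 s4]] := near_matching_edges nC; rewrite Ct in s4.
pose ss := [seq [:: p.1; p.2] | p <- s]; pose D := [set x in flatten ss].
have css : all (fun l => size l == 2) ss by rewrite all_map; apply/allP.
have sss : size ss = t./2 by rewrite size_map.
have sf : size (flatten ss) = 2 * t./2.
  rewrite size_flatten -sss; elim: (ss) css => //= l l' IH /andP[/eqP-> /IH->].
  by rewrite mulnS.
have DC : D \subset C by apply/subsetP => x; rewrite inE => /s3.
have cD : #|D| = 2 * t./2 by rewrite cardsE (card_uniqP s2) sf.
have cR : #|C :\: D| = uphalf t - t./2 by rewrite cardDS // cD Ct; lia.
pose h (x : matching_vertex t) := match x with
  | inl (i, b) => nth x0 (nth [::] ss i) b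
  | inr j => nth x0 (enum (C :\: D)) j end.
have hl i b : h (inl (i, b)) = nth x0 (flatten ss) (2 * i + b).
  by rewrite /= nth_flatten_const ?sss.
have lt (i : 'I_t./2) (b : 'I_2) : 2 * i + b < size (flatten ss).
  by rewrite sf; have := ltn_ord i; have := ltn_ord b; lia.
have hD i b : h (inl (i, b)) \in D by rewrite hl inE mem_nth.
have hR j : h (inr j) \in C :\: D by rewrite -mem_enum mem_nth // -cardE cR.
have hC x : h x \in C.
  by case: x => [[i b]|j]; [apply: (subsetP DC) | case/setDP: (hR j)].
have h_inj : injective h.
  move=> [[i b]|j] [[i' b']|j'].
  - move=> /eqP; rewrite !hl nth_uniq // => /eqP E.
    have [E1 E2] : (i : nat) = i' /\ (b : nat) = b'.
      by move: E (ltn_ord b) (ltn_ord b'); lia.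
    by rewrite (val_inj E1) (val_inj E2).
  - by move=> E; have := hD i b; rewrite E; have /setDP[_ /negbTE->] := hR j'.
  - by move=> E; have := hD i' b'; rewrite -E; have /setDP[_ /negbTE->] := hR j.
  move=> /eqP; rewrite nth_uniq ?enum_uniq -?cardE ?cR // => /eqP E.
  by rewrite (val_inj E).
have h_edge i b : adj G (h (inl (i, b))) (h (inl (i, rev_ord b))).
  rewrite /= (nth_map (x0, x0)) ?s4 //.
  have its : i < size s by rewrite s4.
  have := allP s1 _ (mem_nth (x0, x0) its).
  by case: b => [[|[|b]] hb] //=; rewrite adj_sym.
have /near_matchingP[d1 _] := nC.
have h_partner i b y : y \in C -> adj G (h (inl (i, b))) y -> y = h (inl (i, rev_ord b)).
  move=> yC xy; apply/eqP; rewrite -[_ == _]negbK; apply/negP => ne.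
  have := d1 _ (hC (inl (i, b))); rewrite (degD1 _ _ yC) xy.
  by rewrite (@degD1 _ _ _ (h (inl (i, rev_ord b)))) ?h_edge // !inE eq_sym ne hC.
exists h; split=> //.
have hE x y : adj G (h (inl x)) (h y) = adj (matching_graph t) (inl x) y.
  case: x => i b; apply/idP/idP => [/(h_partner _ _ _ (hC y))/h_inj ->|].
    by have /setP/(_ (inl (i, rev_ord b))) := nbr_matching i b; rewrite !inE eqxx.
  move=> xy; have /setP/(_ y) := nbr_matching i b; rewrite !inE xy => /esym/eqP ->.
  exact: h_edge.
(* At most one vertex is uncovered, so two of them are equal. *)
move=> [x|j] y; first exact: hE.
case: y => [y|j']; first by rewrite adj_sym hE adj_sym.
rewrite adj_matching; suff -> : j = j' by rewrite adj_irr.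
by apply: ord_inj; move: (ltn_ord j) (ltn_ord j'); clear; lia.
Qed.

Lemma split_bijective p t (B : {set V}) (h : matching_vertex t -> V) :
  #|B| = p -> #|~: B| = t -> injective h -> (forall x, h x \in ~: B) ->
  exists2 g : 'I_p + matching_vertex t -> V, bijective g &
    (forall x, g (inl x) \in B) /\ (forall y, g (inr y) = h y).
Proof.
move=> cB; rewrite -{p}cB => ct h_inj hB.
pose g (x : 'I_#|B| + matching_vertex t) :=
  match x with inl i => enum_val i | inr y => h y end.
exists g; last by split=> // x; apply: enum_valP.
apply: inj_card_bij.
  move=> [i|y] [i'|y'] /=.
  - by move/enum_val_inj->.
  - by move=> E; have := enum_valP i; have := hB y'; rewrite -E inE => /negbTE->.
  - by move=> E; have := enum_valP i'; have := hB y; rewrite E inE => /negbTE->.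
  by move/h_inj->.
by rewrite card_sum card_ord card_matching_vertex -ct cardsC.
Qed.

Lemma clique_shape_iso m t : clique_shape (adj G) m setT -> #|V| = 3 * m + 2 + t ->
  isomorphic G (gunion (complete (3 * m + 2)) (matching_graph t)).
Proof.
move=> [B [_ cB /cliqueP cl sep nB]] cV; rewrite setTD in nB sep.
have ct : #|~: B| = t by have := cardsC B; rewrite cB cV => /addnI.
have [h [h_inj hB hE]] := near_matching_embedding nB ct.
have [g g_bij [gB gh]] := split_bijective cB ct h_inj hB.
have g_inj := bij_inj g_bij.
apply/isomorphicP; exists g => // -[i|y] [i'|y'].
- rewrite adj_gunion_l adj_complete; have [->|ne] := eqVneq i i'; first by rewrite adj_irr.
  by apply: cl => //; apply: contraNneq ne => /g_inj[->].
- by rewrite adj_gunion_lr; apply/negbTE/sep; rewrite // gh.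
- by rewrite adj_sym [RHS]adj_sym adj_gunion_lr; apply/negbTE/sep; rewrite // gh.
by rewrite adj_gunion_r !gh hE.
Qed.

Lemma hub_shape_iso m t : hub_shape (adj G) m setT -> #|V| = m + t ->
  isomorphic G (gjoin (complete m) (matching_graph t)).
Proof.
move=> [B [_ cB hub nB]] cV; rewrite setTD in nB.
have ct : #|~: B| = t by have := cardsC B; rewrite cB cV => /addnI.
have [h [h_inj hB hE]] := near_matching_embedding nB ct.
have [g g_bij [gB gh]] := split_bijective cB ct h_inj hB.
have g_inj := bij_inj g_bij.
apply/isomorphicP; exists g => // -[i|y] [i'|y'].
- rewrite adj_gjoin_l adj_complete; have [->|ne] := eqVneq i i'; first by rewrite adj_irr.
  by apply: hub => //; apply: contraNneq ne => /g_inj[->].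
- by rewrite adj_gjoin_lr; apply: hub; rewrite // ?inE //; apply/eqP => /g_inj.
- rewrite adj_sym [RHS]adj_sym adj_gjoin_lr; apply: hub; rewrite // ?inE //.
  by apply/eqP => /g_inj.
by rewrite adj_gjoin_r !gh hE.
Qed.

End Shapes.

(** * Extremal graphs *)

Lemma isomorphic_refl (V : finType) (G : sgraph V) : isomorphic G G.
Proof. by exists id; split=> [|e]; [exists id | rewrite imset_id]. Qed.

Lemma near_matching_isomorphic (V : finType) (G : sgraph V) t :
  near_matching (adj G) setT -> #|V| = t -> isomorphic G (matching_graph t).
Proof.
move=> nG cV; rewrite -cardsT in cV.
have [h [h_inj _ hE]] := near_matching_embedding nG cV; apply/isomorphicP; exists h => //.
by apply: inj_card_bij => //; rewrite card_matching_vertex -cV cardsT.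
Qed.

(** For m = 0 the clique is a single edge, which joins the matching. *)
Lemma clique_shape0 (V : finType) (e : rel V) (A : {set V}) :
  symmetric e -> irreflexive e -> clique_shape e 0 A -> near_matching e A.
Proof.
move=> e_sym e_irr [B [BA cB cl sep nB]]; apply: (near_matching_union e_sym BA) => //.
  apply/near_matchingP; rewrite (vol_clique e_irr cl) cB; split=> // x xB.
  by have := deg_lt_card e_irr xB; rewrite cB.
by rewrite cB.
Qed.

Lemma hub_shape0 (V : finType) (e : rel V) (A : {set V}) :
  hub_shape e 0 A -> near_matching e A.
Proof. by move=> [B [_ /eqP]]; rewrite cards_eq0 => /eqP -> _; rewrite setD0. Qed.

Lemma complete_isomorphicP (V : finType) (G : sgraph V) n : #|V| = n ->
  isomorphic G (complete n) <-> clique (adj G) setT.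
Proof.
move=> cV; split=> [/isomorphicP[g [f fK gK] gE]|cl].
  apply/cliqueP => x y _ _; rewrite -{2}(gK x) -{2}(gK y) gE adj_complete.
  by apply: contraNneq => /(can_inj gK)->.
move: cl; rewrite -{n}cV => /cliqueP cl; apply/isomorphicP.
exists (@enum_val V V); first exact: enum_val_bij.
move=> i j; rewrite adj_complete; have [->|ne] := eqVneq i j; first exact: adj_irr.
rewrite cl ?inE //; by apply: contraNneq ne => /enum_val_inj ->.
Qed.

Lemma relabel (W : finType) (H : sgraph W) :
  exists G : sgraph 'I_#|W|, isomorphic G H.
Proof.
pose E := [set e : {set 'I_#|W|} | enum_val @: e \in edges H].
have E2 : [forall e in E, #|e| == 2].
  by apply: sgraph_proof => e; rewrite inE => /card_edge; rewrite card_imset //; apply: enum_val_inj.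
exists (SGraph E2), enum_val; split; first exact: enum_val_bij.
by move=> e; rewrite inE.
Qed.

(** The first hypothesis contains the upper bound: a graph without [H] having at
    least [N] edges satisfies [P], hence has exactly [N] edges. *)
Lemma extremal_char n (W : finType) (H : sgraph W) N
    (P : forall V : finType, sgraph V -> Prop) :
  (forall (V : finType) (G : sgraph V),
     #|V| = n -> ~~ contains G H -> N <= #|edges G| -> P V G) ->
  (forall (V : finType) (G : sgraph V),
     P V G -> [/\ #|V| = n, #|edges G| = N & ~~ contains G H]) ->
  (exists G : sgraph 'I_n, P _ G) ->
  ex n H = N /\ forall (V : finType) (G : sgraph V), extremal n H G <-> P V G.
Proof.
move=> ub sound [G0 P0]; have exN : ex n H = N.
  have [_ e0 f0] := sound _ _ P0; apply/eqP; rewrite eqn_leq; apply/andP; split.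
    apply/bigmax_leqP => G fG; rewrite leqNgt; apply/negP => lt.
    have [_ e1 _] := sound _ _ (ub _ G (card_ord n) fG (ltnW lt)).
    by rewrite e1 ltnn in lt.
  by rewrite -{1}e0; apply: leq_bigmax_cond.
split=> // V G; rewrite /extremal exN; split=> [[cV eG fG]|/sound//].
by apply: ub; rewrite ?eG.
Qed.

Lemma bin2_double n : 2 * 'C(n, 2) = n * n.-1.
Proof. by elim: n => // n IH; rewrite binS bin1 mulnDr IH; case: n {IH} => //= n; lia. Qed.

Lemma card_edges_complete (V : finType) (G : sgraph V) :
  clique (adj G) setT <-> #|edges G| = 'C(#|V|, 2).
Proof.
have E : vol (adj G) setT = 2 * #|edges G| := vol_edges G.
have B := bin2_double #|V|.
split=> [cl|h]; last by apply: (clique_vol (@adj_sym _ G) (@adj_irr _ G)); rewrite E h B cardsT.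
by have := vol_clique (@adj_irr _ G) cl; rewrite E cardsT -B; lia.
Qed.

Lemma extremal_small m n : n < 3 * m + 3 ->
  ex n (kP3 m.+1) = 'C(n, 2) /\
  forall (V : finType) (G : sgraph V),
    extremal n (kP3 m.+1) G <-> isomorphic G (complete n).
Proof.
move=> hn; apply: (@extremal_char _ _ _ _ (fun V G => isomorphic G (complete n))).
- move=> V G cV _ h; apply/(complete_isomorphicP _ cV).
  apply: (clique_vol (@adj_sym _ G) (@adj_irr _ G)); rewrite vol_edges cardsT cV -bin2_double.
  by rewrite leq_mul2l h.
- move=> V G iso; have cV : #|V| = n by rewrite (isomorphic_card iso) card_ord.
  split=> //; first by rewrite -cV; apply/card_edges_complete/(complete_isomorphicP G cV).
  rewrite contains_kP3; apply/negP => /packable_card; rewrite cardsT cV; lia.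
by exists (complete n); apply: isomorphic_refl.
Qed.

Lemma max_vol_double m n : 3 * m + 2 <= n ->
  max_vol m n = 2 *
    (if n < 5 * m + 4 then 'C(3 * m + 2, 2) + (n - (3 * m + 2))./2
     else if n == 5 * m + 4 then 'C(3 * m + 2, 2) + m.+1
     else 'C(m, 2) + (n - m) * m + (n - m)./2).
Proof.
rewrite /max_vol => h; have b1 := bin2_double m.
have b2 : 2 * 'C(3 * m + 2, 2) = (3 * m + 2) * (3 * m + 1).
  by rewrite bin2_double; congr (_ * _); lia.
case: ltngtP => h5; rewrite [RHS]mulnDr ?[2 * (_ + _ * _)]mulnDr ?b2 ?b1.
- have -> : n - (5 * m + 4) = 0 by lia.
  by rewrite muln0 addn0.
- have [d ->] : exists d, n = 5 * m + 4 + d by exists (n - (5 * m + 4)); lia.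
  have -> : 5 * m + 4 + d - (5 * m + 4) = d by lia.
  have -> : (5 * m + 4 + d - (3 * m + 2))./2 = (m + 1) + d./2 by lia.
  have -> : (5 * m + 4 + d - m)./2 = 2 * m + 2 + d./2 by lia.
  have -> : 5 * m + 4 + d - m = 4 * m + 4 + d by lia.
  by case: m {h h5 b1 b2} => [|m] /=; nia.
rewrite h5 subnn muln0 addn0.
by have -> : (5 * m + 4 - (3 * m + 2))./2 = m.+1 by lia.
Qed.

(** That the bound is attained is seen on the two constructions, relabelled by
    ordinals. *)
Lemma extremal_large m n N : 3 * m + 2 <= n -> 2 * N = max_vol m n ->
  ex n (kP3 m.+1) = N /\
  forall (V : finType) (G : sgraph V),
    extremal n (kP3 m.+1) G <-> #|V| = n /\ extremal_shape (adj G) m setT.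
Proof.
move=> hn hN.
apply: (@extremal_char _ _ _ _ (fun V G => #|V| = n /\ extremal_shape (adj G) m setT)).
- move=> V G cV fG h; split=> //; apply: vol_max_shape; rewrite ?cardsT ?cV //.
  + exact: adj_sym.
  + exact: adj_irr.
  + by rewrite -contains_kP3.
  by rewrite vol_edges -hN leq_mul2l h.
- move=> V G [cV sh]; split=> //.
    have := shape_vol (@adj_sym _ G) (@adj_irr _ G) _ sh.
    by rewrite cardsT cV => /(_ hn); rewrite vol_edges -hN; lia.
  rewrite contains_kP3; case: sh => -[_]; first exact: (clique_shape_nopack (@adj_sym _ G)).
  exact: (hub_shape_nopack (@adj_sym _ G)).
case: (leqP n (5 * m + 4)) => hn5.
  pose T := gunion (complete (3 * m + 2)) (matching_graph (n - (3 * m + 2))).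
  have [G iso] := relabel T.
  have cT : #|{: 'I_(3 * m + 2) + matching_vertex (n - (3 * m + 2))}| = n.
    by rewrite card_sum card_ord card_matching_vertex subnKC.
  move: G iso; rewrite cT => G iso; exists G; split; first exact: card_ord.
  by left; rewrite cardsT card_ord; split=> //; apply: iso_clique_shape iso.
pose T := gjoin (complete m) (matching_graph (n - m)).
have [G iso] := relabel T.
have cT : #|{: 'I_m + matching_vertex (n - m)}| = n.
  by rewrite card_sum card_ord card_matching_vertex subnKC //; lia.
move: G iso; rewrite cT => G iso; exists G; split; first exact: card_ord.
by right; rewrite cardsT card_ord ltnW //; split=> //; apply: iso_hub_shape iso.
Qed.

Lemma clique_shapeP (V : finType) (G : sgraph V) m t :
  #|V| = 3 * m + 2 + t /\ clique_shape (adj G) m setT <->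
  isomorphic G (gunion (complete (3 * m + 2)) (matching_graph t)).
Proof.
split=> [[cV sh]|iso]; first exact: clique_shape_iso.
split; last exact: iso_clique_shape iso.
by rewrite (isomorphic_card iso) card_sum card_ord card_matching_vertex.
Qed.

Lemma hub_shapeP (V : finType) (G : sgraph V) m t :
  #|V| = m + t /\ hub_shape (adj G) m setT <->
  isomorphic G (gjoin (complete m) (matching_graph t)).
Proof.
split=> [[cV sh]|iso]; first exact: hub_shape_iso.
split; last exact: iso_hub_shape iso.
by rewrite (isomorphic_card iso) card_sum card_ord card_matching_vertex.
Qed.

Theorem theorem1p6 (k n : nat) (hk : 1 <= k) (hn : 1 <= n) :
  ex n (kP3 k) =
    (if n < 3 * k then 'C(n, 2)
     else if n < 5 * k - 1 then 'C(3 * k - 1, 2) + (n - 3 * k + 1)./2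
     else if n == 5 * k - 1 then 'C(3 * k - 1, 2) + k
     else 'C(k - 1, 2) + (n - k + 1) * (k - 1) + (n - k + 1)./2)
  /\ (n < 3 * k ->
      forall (V : finType) (G : sgraph V),
        extremal n (kP3 k) G <-> isomorphic G (complete n))
  /\ (3 * k <= n < 5 * k - 1 ->
      forall (V : finType) (G : sgraph V),
        extremal n (kP3 k) G <->
        isomorphic G
          (gunion (complete (3 * k - 1)) (matching_graph (n - 3 * k + 1))))
  /\ (n = 5 * k - 1 ->
      (forall (V : finType) (G : sgraph V),
        extremal n (kP3 k) G <->
        isomorphic G (gunion (complete (3 * k - 1)) (matching_graph (2 * k)))
        \/ isomorphic G (gjoin (complete (k - 1)) (matching_graph (4 * k))))
      /\ (k = 1 ->
          isomorphic (gunion (complete (3 * k - 1)) (matching_graph (2 * k)))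
            (matching_graph 4)
          /\ isomorphic (gjoin (complete (k - 1)) (matching_graph (4 * k)))
            (matching_graph 4)))
  /\ (5 * k - 1 < n ->
      forall (V : finType) (G : sgraph V),
        extremal n (kP3 k) G <->
        isomorphic G
          (gjoin (complete (k - 1)) (matching_graph (n - k + 1)))).
Proof.
case: k hk => // m _.
have -> : 3 * m.+1 - 1 = 3 * m + 2 by lia.
have -> : 5 * m.+1 - 1 = 5 * m + 4 by lia.
have -> : m.+1 - 1 = m by lia.
have k1 : m.+1 = 1 ->
    isomorphic (gunion (complete (3 * m + 2)) (matching_graph (2 * m.+1))) (matching_graph 4) /\
    isomorphic (gjoin (complete m) (matching_graph (4 * m.+1))) (matching_graph 4).
  case=> ->; split; apply: near_matching_isomorphic;
    rewrite ?card_sum ?card_prod ?card_ord //.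
    apply: (clique_shape0 (@adj_sym _ _) (@adj_irr _ _)).
    exact/iso_clique_shape/isomorphic_refl.
  apply: hub_shape0; exact: iso_hub_shape (isomorphic_refl _).
have [hn3|hn3] := ltnP n (3 * m.+1).
  have [|-> small] := @extremal_small m n; first by lia.
  by split=> //; split=> //; split; [lia | split; lia].
have n2 : 3 * m + 2 <= n by lia.
have -> : n - 3 * m.+1 + 1 = n - (3 * m + 2) by lia.
have -> : n - m.+1 + 1 = n - m by lia.
have [-> char] := extremal_large n2 (esym (max_vol_double n2)).
split=> //; split; first by lia.
have cn : n = 3 * m + 2 + (n - (3 * m + 2)) by lia.
have cm : n = m + (n - m) by lia.
split=> [/andP[_ lt] V G|].
  rewrite char -clique_shapeP -cn; split=> -[cV sh]; split=> //.
    by case: sh => -[]; rewrite cardsT cV //; lia.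
  by left; rewrite cardsT cV ltnW.
split=> [nE|gt V G].
  split=> // V G; rewrite char -clique_shapeP -hub_shapeP.
  have -> : 3 * m + 2 + 2 * m.+1 = n by lia.
  have -> : m + 4 * m.+1 = n by lia.
  split=> [[cV [[_ sh]|[_ sh]]]|[[cV sh]|[cV sh]]]; [by left | by right | |]; split=> //.
    by left; rewrite cardsT cV nE.
  by right; rewrite cardsT cV nE.
rewrite char -hub_shapeP -cm; split=> -[cV sh]; split=> //.
  by case: sh => -[]; rewrite cardsT cV //; lia.
by right; rewrite cardsT cV ltnW.
Qed.
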